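(* Let $1<p<+\infty$, and let $c_{2,p}$ be the best (smallest) constant $c$ such that $V_2\big(K+_p(-K)\big)\le c\,V_2(K)$ for all convex bodies $K\subset\mathbb{R}^2$ containing the origin. Then $$c_{2,p}=2\left(1+(p-1)\int_0^{\frac{\pi}{2}}\frac{\sin^{p-2}t\,\cos^{p-2}t}{\big(\sin^p t+\cos^p t\big)^{\frac{2(p-1)}{p}}}\,dt\right).$$
   Context: A convex body in $\mathbb{R}^n$ is a non-empty compact convex subset of $\mathbb{R}^n$; its support function is $h_K(u)=\sup\{\langle x,u\rangle : x\in K\}$, $u\in\mathbb{R}^n$. For a real number $p\ge 1$ and convex bodies $K,L\subset\mathbb{R}^n$ both containing the origin, the $p$-sum $K+_pL$ is the convex body whose support function is $h_{K+_pL}(u)=\big(h_K(u)^p+h_L(u)^p\big)^{1/p}$, $u\in\mathbb{R}^n$. Here $-K=\{-x: x\in K\}$, and $V_2$ denotes area (two-dimensional Lebesgue measure). *)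

(* Defs.v *)
From HB Require Import structures.
From mathcomp Require Import all_boot all_order all_algebra.
From mathcomp Require Import all_classical all_reals all_analysis.

Set Implicit Arguments.
Unset Strict Implicit.
Unset Printing Implicit Defensive.

Import Order.TTheory GRing.Theory Num.Theory.
Import numFieldNormedType.Exports.

Local Open Scope classical_set_scope.
Local Open Scope ring_scope.

Section PlaneConvexBodies.
Context {R : realType}.

(* The plane is R * R: its (product) topology is the Euclidean one, and
   lebesgue_measure \x lebesgue_measure is two-dimensional Lebesgue measure. *)

Definition dot (x u : R * R) : R := x.1 * u.1 + x.2 * u.2.

Definition convex_body (K : set (R * R)) : Prop :=
  [/\ K !=set0, compact K & convex_set K].

Definition support_fun (K : set (R * R)) (u : R * R) : R :=
  sup [set dot x u | x in K].

Definition reflect_body (K : set (R * R)) : set (R * R) := [set - x | x in K].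

Definition area (K : set (R * R)) : \bar R :=
  (@lebesgue_measure R \x @lebesgue_measure R)%E K.

(* M is the p-sum of K and L.  A convex body is determined by its support
   function, so there is at most one such M.  Used only when K and L contain
   the origin; their support functions are then nonnegative, so that powR
   is the usual power. *)
Definition is_psum (p : R) (K L M : set (R * R)) : Prop :=
  convex_body M /\
  forall u, support_fun M u =
    (support_fun K u `^ p + support_fun L u `^ p) `^ p^-1.

Definition psum_area_bound (p c : R) : Prop :=
  forall K M : set (R * R), convex_body K -> K (0, 0) ->
    is_psum p K (reflect_body K) M -> (area M <= c%:E * area K)%E.

Definition is_best_constant (p c : R) : Prop :=
  psum_area_bound p c /\ forall c', psum_area_bound p c' -> c <= c'.

End PlaneConvexBodies.

(* Main.v *)
Require Import Defs.
From HB Require Import structures.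
From mathcomp Require Import all_boot all_order all_algebra.
From mathcomp Require Import all_classical all_reals all_analysis.
From mathcomp Require Import measurable_realfun ring lra.
Set Implicit Arguments.
Unset Strict Implicit.
Unset Printing Implicit Defensive.

Import Order.TTheory GRing.Theory Num.Theory.
Import numFieldNormedType.Exports.
Local Open Scope classical_set_scope.
Local Open Scope ring_scope.

(** Let q = p / (p - 1) and let B be the part of the unit ball of l_q in the
    positive quadrant. Then K +_p (-K) is the union of the bodies a K - b K with
    (a, b) in B. Covering B by a staircase of outer corners P_0, P_1, ..., the
    bodies at P_i and P_(i+1) overlap at least in the body at the inner corner
    between them, so the area of the union is at most the sum over the outer
    corners minus the sum over the inner ones.

    For convex L the difference area(L + C) - area(L) is nondecreasing in L: it is
    so when L is obtained from L' by cutting off a half-plane, because the part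
    cut off can be translated by an extreme point of C out of the remaining sum,
    and every convex L in L' is a countable intersection of such cuts. Since -K is
    contained in a translate of 2 K, increasing a' to a in a' K - b K costs at most
    ((a + 2 b)^2 - (a' + 2 b)^2) area(K). Summing over the staircase and refining
    it gives area(K +_p (-K)) <= (2 + 4 area(B)) area(K); equality holds for a
    triangle with a vertex at the origin. Finally, parametrising the curve
    x^q + y^q = 1 by y / x = (cot t)^(p - 1) turns 2 area(B) into (p - 1) times
    the integral of the statement. *)

(** * Measurability, compactness and scaling for plane area *)

Section AreaBasics.
Context {R : realType}.
Implicit Types (A K L : set (R * R)) (x y z u : R * R).

Local Notation plane := (measurableTypeR R * measurableTypeR R)%type.
Local Notation mu2 := (@lebesgue_measure R \x @lebesgue_measure R)%E.

(** The product sigma-algebra is generated by rectangles; an open set belongs to it as the union of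
    the countably many rational boxes that it contains. *)
Lemma open_measurable_plane A : open A -> measurable (A : set plane).
Proof.
move=> oA.
pose box (q : (rat * rat) * (rat * rat)) : set plane :=
  `]ratr q.1.1, ratr q.1.2[ `*` `]ratr q.2.1, ratr q.2.2[.
rewrite (_ : A = \bigcup_(q in [set: _])
    (if pselect (box q `<=` A) then box q else set0)); last first.
  apply/seteqP; split => [x Ax|x [q _]]; last first.
    by case: pselect => // bA; exact: bA.
  have /nbhs_ballP[e /= e0 eA] : nbhs x A by rewrite nbhsE; exists A.
  have near_rat (a : R) : exists q : rat * rat,
      a - e < ratr q.1 < a /\ a < ratr q.2 < a + e.
    have /rat_in_itvoo[q1] : a - e < a by rewrite ltrBlDr ltrDl.
    have /rat_in_itvoo[q2] : a < a + e by rewrite ltrDl.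
    by rewrite !in_itv /= => h2 h1; exists (q1, q2).
  have [q1 [/andP[h1 h2] /andP[h3 h4]]] := near_rat x.1.
  have [q2 [/andP[h5 h6] /andP[h7 h8]]] := near_rat x.2.
  exists (q1, q2) => //; case: pselect => [?|].
    by split; rewrite /= in_itv/=; apply/andP.
  case=> y -[]; rewrite /= !in_itv/= => /andP[k1 k2] /andP[k3 k4].
  by apply: eA; split; rewrite /ball/= ltr_norml; apply/andP; split; lra.
apply: countable_bigcupT_measurable => [|q]; first exact: countableP.
by case: pselect => ? //=; apply: measurableX; exact: measurable_itv.
Qed.

Lemma compact_measurable_plane A : compact A -> measurable (A : set plane).
Proof.
move=> /(compact_closed (@norm_hausdorff _ _)) /closed_openC.
by move=> /open_measurable_plane /measurableC; rewrite setCK.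
Qed.

(** The left side is a measure in [A], namely a scaled pushforward, so by uniqueness of Lebesgue
    measure it suffices to compare lengths of half-open intervals. *)
Lemma lebesgue_measure_affine (s t : R) (A : set R) : s != 0 ->
  measurable (A : set (measurableTypeR R)) ->
  (`|s|%:E * lebesgue_measure ((fun r => (s * r + t)%R) @^-1` A)
   = lebesgue_measure A)%E.
Proof.
move=> s0 mA.
have mg : measurable_fun [set: measurableTypeR R]
    ((fun r => s * r + t) : measurableTypeR R -> measurableTypeR R).
  by apply: measurable_funD => //; exact: measurable_funM.
pose nu := measure_function_pushforward__canonical__measure_function_Measure
  (@lebesgue_measure R) mg.
transitivity (mscale (NngNum (normr_ge0 s)) nu A) => //.
apply/esym/lebesgue_measure_unique => // _ [[a b] /= _ <-].
rewrite /mscale /= /pushforward /=.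
have [s_gt0|s_le0] := ltP 0 s.
  rewrite (_ : _ @^-1` _ = `](a - t) / s, (b - t) / s]%classic); last first.
    apply/seteqP; split => r /=; rewrite !in_itv/= ltr_pdivrMr// ler_pdivlMr//;
    by rewrite ltrBlDr lerBrDr mulrC.
  rewrite !lebesgue_measure_itv/= !lte_fin ltr_pM2r ?invr_gt0// ltrD2r.
  case: ifPn => _; last by rewrite mule0.
  rewrite gtr0_norm// -!EFinB -EFinM -mulrBl mulrCA divff// mulr1.
  by congr (_%:E); ring.
have s_lt0 : s < 0 by rewrite lt_neqAle s0.
(* A negative factor reverses the interval, so the open end moves to the right. *)
rewrite (_ : _ @^-1` _ = `[(b - t) / s, (a - t) / s[%classic); last first.
  apply/seteqP; split => r /=; rewrite !in_itv/= ltr_ndivlMr// ler_ndivrMr//;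
  by rewrite ltrBlDr lerBrDr mulrC andbC.
rewrite !lebesgue_measure_itv/= !lte_fin ltr_nM2r ?invr_lt0// ltrD2r.
case: ifPn => _; last by rewrite mule0.
rewrite ltr0_norm// -!EFinB -EFinM -mulrBl mulNr mulrCA divff// mulr1.
by congr (_%:E); ring.
Qed.

Lemma area_setX (X Y : set R) :
  measurable (X : set (measurableTypeR R)) ->
  measurable (Y : set (measurableTypeR R)) ->
  area (X `*` Y) = (lebesgue_measure X * lebesgue_measure Y)%E.
Proof. exact: product_measure1E. Qed.

(** Uniqueness of the product measure reduces this to rectangles, where the one-dimensional rule
    applies to each side. *)
Lemma area_preimage_homothety (s : R) (t : R * R) A : s != 0 ->
  measurable (A : set plane) ->
  ((s ^+ 2)%:E * area ((fun z => (s *: z + t)%R) @^-1` A) = area A)%E.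
Proof.
move=> s0 mA.
have mg : measurable_fun [set: plane]
    ((fun z => (s * z.1 + t.1, s * z.2 + t.2)) : plane -> plane).
  by apply: measurable_fun_pair; apply: measurable_funD => //;
    apply: measurable_funM.
pose nu := measure_function_pushforward__canonical__measure_function_Measure
  mu2 mg.
transitivity (mscale (NngNum (sqr_ge0 s)) nu A) => //.
apply/esym/product_measure_unique => // X Y mX mY.
transitivity ((s ^+ 2)%:E * area (((fun r => (s * r + t.1)%R) @^-1` X) `*`
                                 ((fun r => (s * r + t.2)%R) @^-1` Y)))%E => //.
have mf (c : R) : measurable_fun [set: measurableTypeR R]
    ((fun r => s * r + c) : measurableTypeR R -> measurableTypeR R).
  by apply: measurable_funD => //; exact: measurable_funM.
rewrite area_setX.
- rewrite -[RHS]/(lebesgue_measure X * lebesgue_measure Y)%E.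
  rewrite -(lebesgue_measure_affine t.1 s0 mX) -(lebesgue_measure_affine t.2 s0 mY).
  by rewrite muleACA -EFinM -normrM ger0_norm// -expr2 sqr_ge0.
- by rewrite -[X in measurable X]setTI; exact: mf.
- by rewrite -[X in measurable X]setTI; exact: mf.
Qed.

Lemma compact_comb (a b : R) K L : compact K -> compact L ->
  compact [set a *: x + b *: y | x in K & y in L].
Proof.
move=> cK cL.
rewrite (_ : image2 _ _ _ = (fun z : (R * R) * (R * R) => a *: z.1 + b *: z.2)
    @` (K `*` L)); last first.
  apply/seteqP; split => [_ [x Kx [y Ly <-]]|_ [[x y] [/= Kx Ly] <-]].
    by exists (x, y).
  by exists x => //; exists y.
apply: continuous_compact; last exact: compact_setX.
apply: continuous_subspaceT => z; apply: cvgD; apply: cvgZr.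
  exact: cvg_fst.
exact: cvg_snd.
Qed.

Lemma compact_homothety (s : R) (t : R * R) A : compact A ->
  compact [set s *: z + t | z in A].
Proof.
move=> cA; apply: continuous_compact => //.
apply: continuous_subspaceT => z; apply: cvgD; last exact: cvg_cst.
by apply: cvgZr; exact: cvg_id.
Qed.

Lemma area_homothety (s : R) (t : R * R) A : compact A ->
  area [set s *: z + t | z in A] = ((s ^+ 2)%:E * area A)%E.
Proof.
move=> cA; have cB : compact [set s *: z + t | z in A] by exact: compact_homothety.
have [s0|s0] := eqVneq s 0; last first.
  rewrite -(@area_preimage_homothety s t)//; last exact: compact_measurable_plane.
  congr (_ * area _)%E; apply/seteqP; split => [z [x Ax]|z Az]; last by exists z.
  by move=> /(@addIr _ _ _ _) /(scalerI s0) <-.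
(* For [s = 0] the image lies in the single point [t], which is null. *)
rewrite s0 expr0n/= mul0e; apply/eqP; rewrite eq_le measure_ge0 andbT.
apply: (@le_trans _ _ (area ([set t.1] `*` [set t.2]))).
  apply: le_measure; rewrite ?inE.
  - by rewrite s0 in cB; exact: compact_measurable_plane.
  - by apply: measurableX; exact: measurable_set1.
  - by move=> _ [z _ <-]; rewrite scale0r add0r.
by rewrite area_setX// lebesgue_measure_set1 mul0e.
Qed.

Lemma compact_bounded_plane A : compact A ->
  exists2 M : R, 0 < M & forall z, A z -> `|z.1| <= M /\ `|z.2| <= M.
Proof.
move=> /compact_bounded /pinfty_ex_gt0[M M0 AM]; exists M => // z /AM.
by rewrite /= prod_normE ge_max => /andP.
Qed.

Lemma area_compact_fin A : compact A -> area A \is a fin_num.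
Proof.
move=> cA; have [M _ AM] := compact_bounded_plane cA.
rewrite ge0_fin_numE ?measure_ge0//.
apply: (@le_lt_trans _ _ (area (`[-M, M] `*` `[-M, M]))).
  apply: le_measure; rewrite ?inE.
  - exact: compact_measurable_plane.
  - by apply: measurableX; exact: measurable_itv.
  - by move=> z /AM[? ?]; split; rewrite /= in_itv/= -ler_norml.
rewrite area_setX; [|exact: measurable_itv..].
rewrite !lebesgue_measure_itv/=; by case: ifPn => _; rewrite ?mule0 ?ltry.
Qed.

End AreaBasics.

(** * Separating a point from a planar convex body *)

Section Separation.
Context {R : realType}.
Implicit Types (K L : set (R * R)) (x y z u : R * R).

Lemma convex_setE K x y (t : R) : convex_set K -> K x -> K y ->
  0 <= t -> t <= 1 -> K (t *: x + (1 - t) *: y).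
Proof.
move=> cK Kx Ky t0 t1.
by have /set_mem := cK x y (Itv01 t0 t1) (mem_set Kx) (mem_set Ky).
Qed.

Lemma convex_setI01 K :
  (forall x y (t : R), K x -> K y -> 0 <= t -> t <= 1 -> K (t *: x + (1 - t) *: y)) ->
  convex_set K.
Proof.
move=> cK x y t /set_mem Kx /set_mem Ky; apply/mem_set.
exact: (cK x y t%:num).
Qed.

Lemma dotDl x y u : dot (x + y) u = dot x u + dot y u.
Proof. by rewrite /dot/=; ring. Qed.

Lemma dotZl (a : R) x u : dot (a *: x) u = a * dot x u.
Proof. by rewrite /dot/= /GRing.scale/=; ring. Qed.

Lemma dotNl x u : dot (- x) u = - dot x u.
Proof. by rewrite /dot/=; ring. Qed.

Lemma continuous_dot u : continuous (fun x => dot x u).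
Proof.
move=> x; apply: cvgD; (apply: cvgM; last exact: cvg_cst).
  exact: cvg_fst.
exact: cvg_snd.
Qed.

(** The separating line passes through the point [x0] of [K] nearest to [z], orthogonally to
    [z - x0]. *)
Lemma separation K z : K !=set0 -> compact K -> convex_set K -> ~ K z ->
  exists u c, (forall x, K x -> dot x u <= c) /\ c < dot z u.
Proof.
move=> K0 cK vK nKz.
pose f x := dot (z - x) (z - x).
have [x0 /set_mem Kx0 x0min] : exists2 x, x \in K & forall y, y \in K -> f x <= f y.
  apply: compact_EVT_min => //; apply: continuous_subspaceT.
  have c1 : continuous (fun x : R * R => z.1 - x.1).
    by move=> x; apply: cvgB; [exact: cvg_cst|exact: cvg_fst].
  have c2 : continuous (fun x : R * R => z.2 - x.2).
    by move=> x; apply: cvgB; [exact: cvg_cst|exact: cvg_snd].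
  move=> x; apply: cvgD; apply: cvgM; [exact: c1|exact: c1|exact: c2|exact: c2].
exists (z - x0), (dot x0 (z - x0)); split; last first.
  rewrite -subr_gt0 -dotNl -dotDl /dot -!expr2 lt_neqAle addr_ge0 ?sqr_ge0// andbT.
  apply: contra_notN nKz => /eqP/esym/eqP; rewrite paddr_eq0 ?sqr_ge0//.
  rewrite !sqrf_eq0 !subr_eq0 => /andP[/eqP h1 /eqP h2].
  by rewrite (surjective_pairing z) h1 h2 -surjective_pairing.
move=> x Kx; rewrite -subr_le0 -dotNl -dotDl.
(* The squared distance from [z] to [x0 + t (x - x0)] is quadratic in [t] and
   minimal at [0]. *)
rewrite leNgt; apply/negP => d_gt0.
set d := dot (x - x0) (z - x0) in d_gt0.
pose e := dot (x - x0) (x - x0).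
have e_ge0 : 0 <= e by rewrite /e /dot -!expr2 addr_ge0 ?sqr_ge0.
pose t := d / (d + e + 1).
have D_gt0 : 0 < d + e + 1 by lra.
have t_gt0 : 0 < t by rewrite divr_gt0.
have t_le1 : t <= 1 by rewrite ler_pdivrMr//; lra.
have := x0min _ (mem_set (convex_setE vK Kx Kx0 (ltW t_gt0) t_le1)).
have -> : f (t *: x + (1 - t) *: x0) = f x0 - 2 * t * d + t ^+ 2 * e.
  rewrite /f /d /e; move: t {t_gt0 t_le1} => t.
  by rewrite /dot/= /GRing.scale/=; ring.
apply/negP; rewrite -ltNge.
suff : t * e < 2 * d by nra.
rewrite /t mulrAC ltr_pdivrMr//; nra.
Qed.

(** Rational data present [K] as a countable intersection of half-planes. The strict gap left by
    [separation] survives a small change of the normal, uniformly on a box containing [K] and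
    [z]. *)
Lemma separation_rat K z : K !=set0 -> compact K -> convex_set K -> ~ K z ->
  exists q : rat * rat * rat,
    (forall x, K x -> dot x (ratr q.1.1, ratr q.1.2) <= ratr q.2) /\
    ratr q.2 < dot z (ratr q.1.1, ratr q.1.2).
Proof.
move=> K0 cK vK nKz.
have [u [c [Kc cz]]] := separation K0 cK vK nKz.
have [M M0 KM] := compact_bounded_plane cK.
pose B := M + `|z.1| + `|z.2|.
have B0 : 0 < B by rewrite ltr_wpDr// ltr_wpDr.
(* Replacing the normal costs at most [2 * (B * e)] on the side of [K] and as much on the side of
   [z]; a gap of [5 * (B * e)] leaves room for a rational level. *)
pose e := (dot z u - c) / (5 * B).
have e0 : 0 < e by rewrite divr_gt0 ?subr_gt0 ?mulr_gt0.
have near_rat (a : R) : exists q : rat, `|ratr q - a| <= e.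
  have /rat_in_itvoo[q] : a < a + e by rewrite ltrDl.
  rewrite in_itv/= => /andP[h1 h2]; exists q.
  by rewrite ler_norml; apply/andP; split; lra.
have [q1 h1] := near_rat u.1; have [q2 h2] := near_rat u.2.
have close x : `|x.1| <= B -> `|x.2| <= B ->
    `|dot x (ratr q1, ratr q2) - dot x u| <= 2 * (B * e).
  move=> x1 x2; rewrite (_ : _ - _ = x.1 * (ratr q1 - u.1) + x.2 * (ratr q2 - u.2)).
    rewrite (le_trans (ler_normD _ _))// !normrM mulr_natl mulr2n.
    by rewrite lerD// ler_pM.
  by rewrite /dot/=; ring.
have Be : 5 * (B * e) = dot z u - c.
  by rewrite /e mulrA [5 * B * _]mulrC divfK// gt_eqF// mulr_gt0.
have [|q] := @rat_in_itvoo _ (c + 2 * (B * e)) (dot z (ratr q1, ratr q2)).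
  have z1B : `|z.1| <= B by rewrite /B addrAC lerDr addr_ge0// ltW.
  have z2B : `|z.2| <= B by rewrite /B lerDr addr_ge0// ltW.
  have := close z z1B z2B; rewrite ler_norml => /andP[+ _].
  have : 0 < B * e by rewrite mulr_gt0.
  lra.
rewrite in_itv/= => /andP[cq qz]; exists (q1, q2, q); split=> //= x Kx.
have [x1 x2] := KM x Kx.
have MB : M <= B by rewrite /B -addrA lerDl addr_ge0.
have := close x (le_trans x1 MB) (le_trans x2 MB); rewrite ler_norml => /andP[_].
have := Kc x Kx; lra.
Qed.

End Separation.

(** * Monotonicity of the area gained by adding a fixed compact set *)

Section MinkowskiMonotone.
Context {R : realType}.
Implicit Types (K L : set (R * R)) (x y z u : R * R).

Local Notation plane := (measurableTypeR R * measurableTypeR R)%type.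

Definition minkowski_sum K L : set (R * R) := [set x + y | x in K & y in L].

Definition vol K : R := fine (area K).

Lemma areaE K : compact K -> area K = (vol K)%:E.
Proof. by move=> cK; rewrite /vol fineK// area_compact_fin. Qed.

Lemma vol_ge0 K : 0 <= vol K.
Proof. by rewrite /vol fine_ge0// measure_ge0. Qed.

Lemma vol_le K L : compact K -> compact L -> K `<=` L -> vol K <= vol L.
Proof.
move=> cK cL KL; rewrite -lee_fin -!areaE//.
by apply: le_measure => //; rewrite inE; exact: compact_measurable_plane.
Qed.

Lemma vol_setU K L : compact K -> compact L ->
  vol (K `|` L) = vol K + vol L - vol (K `&` L).
Proof.
move=> cK cL.
have cKL : compact (K `&` L).
  by apply: compact_closedI => //; exact: (compact_closed (@norm_hausdorff _ _)).
apply/EFin_inj; rewrite EFinB EFinD -!areaE//; last exact: compactU.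
apply: measureUfinl; [exact: compact_measurable_plane..|].
by rewrite -ge0_fin_numE ?measure_ge0//; exact: area_compact_fin.
Qed.

Lemma vol_homothety (s : R) (t : R * R) K : compact K ->
  vol [set s *: z + t | z in K] = s ^+ 2 * vol K.
Proof.
move=> cK; apply/EFin_inj; rewrite EFinM -!areaE ?area_homothety//.
exact: compact_homothety.
Qed.

Lemma compact_minkowski_sum K L : compact K -> compact L ->
  compact (minkowski_sum K L).
Proof.
move=> cK cL; rewrite /minkowski_sum.
rewrite (_ : image2 _ _ _ = [set 1 *: x + 1 *: y | x in K & y in L]).
  exact: compact_comb.
by congr image2; apply/funext => x; apply/funext => y; rewrite !scale1r.
Qed.

Lemma minkowski_sumS K L K' L' : K `<=` K' -> L `<=` L' ->
  minkowski_sum K L `<=` minkowski_sum K' L'.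
Proof.
by move=> KK LL _ [x /KK ? [y /LL ? <-]]; exists x => //; exists y.
Qed.

Lemma closed_halfplane u (c : R) : closed [set z | dot z u <= c].
Proof.
rewrite (_ : [set z | _] = (fun z => dot z u) @^-1` [set r | r <= c])//.
apply: closed_comp; last exact: closed_le.
by move=> z _; exact: continuous_dot.
Qed.

(* A point [k] of [K] extreme in direction [u] moves the part of [L] cut off by
   the half-plane out of the sum of the remaining part with [K]. *)
Lemma vol_minkowski_cut K L u (c : R) : compact K -> K !=set0 -> compact L ->
  vol (minkowski_sum (L `&` [set z | dot z u <= c]) K) + vol L <=
  vol (minkowski_sum L K) + vol (L `&` [set z | dot z u <= c]).
Proof.
move=> cK K0 cL; set H := [set z | _].
have clH : closed H by exact: closed_halfplane.
have cLH : compact (L `&` H) by exact: compact_closedI.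
have mH : measurable (H : set plane).
  by move/closed_openC/open_measurable_plane/measurableC : clH; rewrite setCK.
have mL := compact_measurable_plane cL.
have [k /set_mem Kk kmax] : exists2 k, k \in K &
    forall y, y \in K -> dot y u <= dot k u.
  by apply: compact_EVT_max => //; apply: continuous_subspaceT; exact: continuous_dot.
rewrite -lee_fin !EFinD -!areaE//; try exact: compact_minkowski_sum.
have -> : area L = (area (L `&` H) + area (L `\` H))%E.
  by rewrite addeC /area (measureDI _ mL mH).
rewrite addeCA [leRHS]addeC leeD2l//.
pose T := (fun z => 1 *: z + (- k)) @^-1` (L `\` H).
have mLH : measurable (L `\` H : set plane) by exact: measurableD.
have -> : area (L `\` H) = area T.
  by rewrite -(@area_preimage_homothety _ 1 (- k) _ _ mLH) ?oner_neq0// expr1n mul1e.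
have TE : T = [set 1 *: z + k | z in L] `&` ~` [set z | dot z u <= c + dot k u].
  apply/seteqP; split => [z|_ [[z Lz <-] /= /negP]].
    rewrite /T/= scale1r => -[Lz /negP]; rewrite -ltNge dotDl dotNl ltrBrDr => h.
    by split; [exists (z - k) => //; rewrite scale1r subrK|apply/negP; rewrite -ltNge].
  rewrite -ltNge !scale1r dotDl ltrD2r => h.
  by rewrite /T /= scale1r addrK; split => //; apply/negP; rewrite -ltNge.
have mT : measurable (T : set plane).
  rewrite TE; apply: measurableI.
    by apply: compact_measurable_plane; exact: compact_homothety.
  by apply: open_measurable_plane; apply: closed_openC; exact: closed_halfplane.
have mS : measurable (minkowski_sum (L `&` H) K : set plane).
  by apply: compact_measurable_plane; exact: compact_minkowski_sum.
(* Disjointness: [T] lies strictly above the level [c + dot k u] in direction [u], and the sum of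
   the remaining part with [K] does not exceed it. *)
rewrite -[leLHS](measureU _ mS mT); last first.
  apply/seteqP; split => // z [[x [_ Hx] [y Ky <-]]]; rewrite TE => -[_]; apply.
  by rewrite /= dotDl lerD// kmax// inE.
apply: le_measure; rewrite ?inE; first exact: measurableU.
  by apply: compact_measurable_plane; exact: compact_minkowski_sum.
move=> z [|]; first by apply: minkowski_sumS => // ? [].
by rewrite TE => -[[x Lx <-] _]; rewrite scale1r; exists x => //; exists k.
Qed.

(** [L'] is cut down to [L] by the rational half-planes containing [L], one after another. Each cut
    preserves the inequality by [vol_minkowski_cut], and continuity of the measure from above gives
    the limit. *)
Lemma vol_minkowski_mono K L L' : compact K -> K !=set0 ->
  L !=set0 -> compact L -> convex_set L -> compact L' -> L `<=` L' ->
  vol (minkowski_sum L K) + vol L' <= vol (minkowski_sum L' K) + vol L.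
Proof.
move=> cK K0 L0 cL vL cL' LL'.
pose hp (q : rat * rat * rat) : set (R * R) :=
  [set z | dot z (ratr q.1.1, ratr q.1.2) <= ratr q.2].
(* Indices that decode to nothing, or to a half-plane not containing [L], leave the set
   unchanged. *)
pose cut n (S : set (R * R)) :=
  if unpickle n is Some q then
    if pselect (L `<=` hp q) then S `&` hp q else S
  else S.
pose S := fix S n := if n is m.+1 then cut m (S m) else L'.
have LS n : L `<=` S n.
  elim: n => //= n IH; rewrite /cut; case: unpickle => // q.
  by case: pselect => //= Lq z Lz; split; [exact: IH|exact: Lq].
have cS n : compact (S n).
  elim: n => //= n IH; rewrite /cut; case: unpickle => // q.
  by case: pselect => //= _; apply: compact_closedI => //; exact: closed_halfplane.
have SS n : S n.+1 `<=` S n.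
  rewrite /= /cut; case: unpickle => // q.
  by case: pselect => ? /=; [exact: subIsetl|exact: subset_refl].
have SE : \bigcap_n S n = L.
  apply/seteqP; split => [z Sz|z Lz n _]; last exact: LS.
  apply: contrapT => /(separation_rat L0 cL vL)[q [Lq qz]].
  have [m mq] : exists m, unpickle m = Some q by exists (pickle q); exact: pickleK.
  have := Sz m.+1 I; rewrite /= /cut mq.
  case: pselect => [_ [_ hz]|/(_ Lq)//].
  by move: qz; rewrite ltNge; apply/negP; rewrite negbK.
have step n : vol (minkowski_sum (S n) K) + vol L' <=
    vol (minkowski_sum L' K) + vol (S n).
  elim: n => [//|n IH]; rewrite /= /cut; case: unpickle => // q.
  case: pselect => //= _.
  have := vol_minkowski_cut (ratr q.1.1, ratr q.1.2) (ratr q.2) cK K0 (cS n).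
  rewrite -/(hp q); move: (vol (minkowski_sum (S n `&` hp q) K)) (vol (S n `&` hp q))
    (vol (minkowski_sum (S n) K)) (vol (minkowski_sum L' K)) (vol (S n)) (vol L') IH.
  by move=> a b c d e l h1 h2; lra.
rewrite -lerBlDl -lee_fin -(areaE cL).
have -> : area L = area (\bigcap_n S n) by rewrite SE.
apply: (@cvge_ge _ \oo _ _ (area \o S)); last first.
  apply: nonincreasing_cvg_mu.
  - by rewrite -ge0_fin_numE ?measure_ge0//; exact: area_compact_fin.
  - by move=> n; exact: compact_measurable_plane.
  - by rewrite SE; exact: compact_measurable_plane.
  - by apply/nonincreasing_seqP => n; apply/subsetPset; exact: SS.
(* The sum of [S n] and [K] contains that of [L] and [K], so the limit is taken in [vol (S n)]
   alone. *)
near=> n; rewrite /= areaE// lee_fin lerBlDl.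
apply: le_trans (step n); rewrite lerD2r; apply: vol_le.
- exact: compact_minkowski_sum.
- exact: compact_minkowski_sum.
- by apply: minkowski_sumS => //; exact: LS.
Unshelve. all: by end_near. Qed.

End MinkowskiMonotone.

(** * Inclusion of -K in a translate of 2 K, and the growth of a K - b K in a *)

Section DilatedDifference.
Context {R : realType}.
Implicit Types (K L : set (R * R)) (x y z u : R * R).

Definition comb K L (a b : R) : set (R * R) :=
  [set a *: x + b *: y | x in K & y in L].

(** The nontrivial inclusion in s K + r K = (s + r) K. If [s + r = 0], both coefficients vanish and
    any point serves as [w]. *)
Lemma convex_combD K (s r : R) x y : convex_set K -> K x -> K y ->
  0 <= s -> 0 <= r -> exists2 w, K w & s *: x + r *: y = (s + r) *: w.
Proof.
move=> vK Kx Ky s0 r0; have [sr0|sr0] := eqVneq (s + r) 0.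
  move: (sr0) => /eqP; rewrite paddr_eq0// => /andP[/eqP-> /eqP->].
  by exists x => //; rewrite addr0 !scale0r addr0.
have sr_gt0 : 0 < s + r by rewrite lt_neqAle eq_sym sr0 addr_ge0.
exists (s / (s + r) *: x + (1 - s / (s + r)) *: y).
  apply: convex_setE => //; first by rewrite divr_ge0// ltW.
  by rewrite ler_pdivrMr// mul1r lerDl.
by rewrite scalerDr !scalerA mulrBr mulr1 mulrCA divff// mulr1 [s + r]addrC addrK.
Qed.

Lemma plane_eq x y : x.1 = y.1 -> x.2 = y.2 -> x = y.
Proof. by case: x => ? ?; case: y => ? ? /= -> ->. Qed.

Lemma continuous_coordB (T : topologicalType) (g h : T -> R * R) :
  continuous g -> continuous h ->
  continuous (fun v => (g v).1 - (h v).1) /\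
  continuous (fun v => (g v).2 - (h v).2).
Proof.
move=> cg ch; split=> v; apply: cvgB.
- by apply: (@cvg_comp _ _ _ g fst); [exact: cg|exact: cvg_fst].
- by apply: (@cvg_comp _ _ _ h fst); [exact: ch|exact: cvg_fst].
- by apply: (@cvg_comp _ _ _ g snd); [exact: cg|exact: cvg_snd].
- by apply: (@cvg_comp _ _ _ h snd); [exact: ch|exact: cvg_snd].
Qed.

(** The degenerate case of [reflect_sub2]. A farthest pair [p1], [p2] of points of [K] are the ends
    of the segment containing [K]. *)
Lemma reflect_collinear_sub2 K : K !=set0 -> compact K -> convex_set K ->
  (forall x y z, K x -> K y -> K z ->
    (y.1 - x.1) * (z.2 - x.2) = (y.2 - x.2) * (z.1 - x.1)) ->
  exists t, forall x, K x -> exists2 k, K k & - x = 2 *: k + t.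
Proof.
move=> [z0 Kz0] cK vK colK.
pose f (v : (R * R) * (R * R)) : R := dot (v.2 - v.1) (v.2 - v.1).
have [[p1 p2] /set_mem[/= Kp1 Kp2] pmax] : exists2 v, v \in K `*` K &
    forall w, w \in K `*` K -> f w <= f v.
  apply: compact_EVT_max; [by exists (z0, z0)|exact: compact_setX|].
  have [c1 c2] := @continuous_coordB ((R * R) * (R * R))%type snd fst
    (fun v => @cvg_snd _ _ _ _ _) (fun v => @cvg_fst _ _ _ _ _).
  apply: continuous_subspaceT => v.
  by apply: cvgD; apply: cvgM; [exact: c1|exact: c1|exact: c2|exact: c2].
set m := f (p1, p2) in pmax.
have mE : m = (p2.1 - p1.1) ^+ 2 + (p2.2 - p1.2) ^+ 2 by rewrite /m /f /dot/=; ring.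
exists (- (p1 + 2 *: p2)) => x Kx.
have xp1 : f (p1, x) <= m by apply: pmax; rewrite inE.
have xp2 : f (p2, x) <= m by apply: pmax; rewrite inE.
have fE v : f v = (v.2.1 - v.1.1) ^+ 2 + (v.2.2 - v.1.2) ^+ 2.
  by rewrite /f /dot/=; ring.
rewrite !fE/= in xp1 xp2.
have [m0|m0] := eqVneq m 0.
  exists p2 => //; rewrite opprD addrCA addrN addr0; congr (- _).
  have : (x.1 - p1.1) ^+ 2 + (x.2 - p1.2) ^+ 2 == 0.
    by rewrite eq_le -{1}m0 xp1 addr_ge0// sqr_ge0.
  rewrite paddr_eq0 ?sqr_ge0// !sqrf_eq0 !subr_eq0 => /andP[/eqP h1 /eqP h2].
  exact: plane_eq.
have m_gt0 : 0 < m by rewrite lt_neqAle eq_sym m0 mE addr_ge0 ?sqr_ge0.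
have := colK p1 p2 x Kp1 Kp2 Kx => col.
pose mu := ((x.1 - p1.1) * (p2.1 - p1.1) + (x.2 - p1.2) * (p2.2 - p1.2)) / m.
have x1E : x.1 = p1.1 + mu * (p2.1 - p1.1).
  apply: (mulIf m0); rewrite mulrDl mulrAC /mu divfK// mE.
  transitivity (p1.1 * ((p2.1 - p1.1) ^+ 2 + (p2.2 - p1.2) ^+ 2) +
    (x.1 - p1.1) * (p2.1 - p1.1) ^+ 2 +
    (p2.2 - p1.2) * ((p2.2 - p1.2) * (x.1 - p1.1))); first ring.
  by rewrite -col; ring.
have x2E : x.2 = p1.2 + mu * (p2.2 - p1.2).
  apply: (mulIf m0); rewrite mulrDl mulrAC /mu divfK// mE.
  transitivity (p1.2 * ((p2.1 - p1.1) ^+ 2 + (p2.2 - p1.2) ^+ 2) +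
    (x.2 - p1.2) * (p2.2 - p1.2) ^+ 2 +
    (p2.1 - p1.1) * ((p2.1 - p1.1) * (x.2 - p1.2))); first ring.
  by rewrite col; ring.
(* As [x] is no farther from [p1] or [p2] than these are from each other, its coordinate [mu] along
   the segment lies between 0 and 1. *)
have mu_le1 : mu ^+ 2 <= 1.
  rewrite -(ler_pM2r m_gt0) mul1r; apply: le_trans xp1.
  by rewrite x1E x2E mE le_eqVlt; apply/orP; left; apply/eqP; ring.
have mu_ge0 : (1 - mu) ^+ 2 <= 1.
  rewrite -(ler_pM2r m_gt0) mul1r; apply: le_trans xp2.
  by rewrite x1E x2E mE le_eqVlt; apply/orP; left; apply/eqP; ring.
exists (mu / 2 *: p1 + (1 - mu / 2) *: p2).
  by apply: convex_setE => //; nra.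
by apply: plane_eq; rewrite /= /GRing.scale/= ?x1E ?x2E; field.
Qed.

(* [p1 p2 p3] is an inscribed triangle of maximal area; the barycentric
   coordinates of any point of [K] are then at most [1]. *)
Lemma reflect_sub2 K : K !=set0 -> compact K -> convex_set K ->
  exists t, forall x, K x -> exists2 k, K k & - x = 2 *: k + t.
Proof.
move=> K0 cK vK.
pose D x y z : R := (y.1 - x.1) * (z.2 - x.2) - (y.2 - x.2) * (z.1 - x.1).
pose f (v : (R * R) * (R * R) * (R * R)) : R := D v.1.1 v.1.2 v.2.
have [[[p1 p2] p3] /set_mem[/= [/= Kp1 Kp2] Kp3] pmax] :
    exists2 v, v \in K `*` K `*` K & forall w, w \in K `*` K `*` K -> f w <= f v.
  apply: compact_EVT_max.
  - by case: K0 => z Kz; exists ((z, z), z).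
  - by apply: compact_setX => //; exact: compact_setX.
  have c11 : continuous (fun v : (R * R) * (R * R) * (R * R) => v.1.1).
    move=> v; apply: (@cvg_comp _ _ _ fst fst); exact: cvg_fst.
  have c12 : continuous (fun v : (R * R) * (R * R) * (R * R) => v.1.2).
    move=> v; apply: (@cvg_comp _ _ _ fst snd); first exact: cvg_fst.
    exact: cvg_snd.
  have c2 : continuous (fun v : (R * R) * (R * R) * (R * R) => v.2).
    move=> v; exact: cvg_snd.
  have [h1 h2] := continuous_coordB c12 c11.
  have [h3 h4] := continuous_coordB c2 c11.
  apply: continuous_subspaceT => v.
  by apply: cvgB; apply: cvgM; [exact: h1|exact: h4|exact: h2|exact: h3].
set d := f (p1, p2, p3) in pmax.
have D_le x y z : K x -> K y -> K z -> D x y z <= d.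
  by move=> *; apply: (pmax (x, y, z)); rewrite inE.
(* Exchanging two vertices changes the sign of [D], so a nonpositive maximum forces all triples to
   be collinear. *)
have [d_le0|d_gt0] := leP d 0.
  apply: reflect_collinear_sub2 => // x y z Kx Ky Kz; apply/eqP.
  have h1 := D_le x y z Kx Ky Kz; have h2 := D_le x z y Kx Kz Ky.
  rewrite /D in h1 h2; rewrite eq_le; apply/andP; split; lra.
exists (- (p1 + p2 + p3)) => x Kx.
pose l1 := D x p2 p3 / d; pose l2 := D p1 x p3 / d; pose l3 := D p1 p2 x / d.
have l1_le1 : l1 <= 1 by rewrite ler_pdivrMr// mul1r D_le.
have l2_le1 : l2 <= 1 by rewrite ler_pdivrMr// mul1r D_le.
have l3_le1 : l3 <= 1 by rewrite ler_pdivrMr// mul1r D_le.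
have d_neq0 : d != 0 by rewrite gt_eqF.
have dE : d = D p1 p2 p3 by [].
have lE : l1 + l2 + l3 = 1.
  rewrite /l1 /l2 /l3 -!mulrDl; apply: (mulIf d_neq0).
  by rewrite divfK// mul1r dE /D; ring.
have x1E : x.1 = l1 * p1.1 + l2 * p2.1 + l3 * p3.1.
  apply: (mulIf d_neq0); rewrite !mulrDl.
  rewrite (mulrAC l1) (mulrAC l2) (mulrAC l3) /l1 /l2 /l3 !divfK// dE /D; ring.
have x2E : x.2 = l1 * p1.2 + l2 * p2.2 + l3 * p3.2.
  apply: (mulIf d_neq0); rewrite !mulrDl.
  rewrite (mulrAC l1) (mulrAC l2) (mulrAC l3) /l1 /l2 /l3 !divfK// dE /D; ring.
(* Since -x is the sum of the (1 - l_i) p_i minus the sum of the p_i, the point [k] must have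
   weights (1 - l_i) / 2. They are nonnegative and add up to 1; two uses of [convex_combD] assemble
   it. *)
have [||w Kw wE] := @convex_combD K ((1 - l1) / 2) ((1 - l2) / 2) _ _ vK Kp1 Kp2.
- by rewrite divr_ge0// subr_ge0.
- by rewrite divr_ge0// subr_ge0.
have [||k Kk kE] := @convex_combD K ((1 - l1) / 2 + (1 - l2) / 2) ((1 - l3) / 2)
  _ _ vK Kw Kp3.
- by rewrite addr_ge0// divr_ge0// subr_ge0.
- by rewrite divr_ge0// subr_ge0.
exists k => //.
rewrite -wE in kE.
have k1 : (1 - l1) / 2 + (1 - l2) / 2 + (1 - l3) / 2 = 1 by lra.
rewrite k1 scale1r in kE.
by apply: plane_eq; rewrite -kE /= /GRing.scale/= ?x1E ?x2E; field.
Qed.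

Lemma compact_reflect_body K : compact K -> compact (reflect_body K).
Proof.
move=> cK; apply: continuous_compact => //; apply: continuous_subspaceT => x.
by apply: cvgN; exact: cvg_id.
Qed.

(* Up to a translation, [a' K - b K] lies in [(a' + 2 b) K]. *)
Lemma vol_comb_increment K (a a' b : R) : K !=set0 -> compact K -> convex_set K ->
  0 <= a' -> a' <= a -> 0 <= b ->
  vol (comb K (reflect_body K) a b) + (a' + 2 * b) ^+ 2 * vol K <=
  (a + 2 * b) ^+ 2 * vol K + vol (comb K (reflect_body K) a' b).
Proof.
move=> K0 cK vK a'0 a'a b0.
have [t Kt] := reflect_sub2 K0 cK vK.
have cN := compact_reflect_body cK.
pose dil := [set (a - a') *: z + 0 | z in K].
pose big := [set (a' + 2 * b) *: z + b *: t | z in K].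
have cdil : compact dil by exact: compact_homothety.
have cbig : compact big by exact: compact_homothety.
have cC c : compact (comb K (reflect_body K) c b) by exact: compact_comb.
have dil0 : dil !=set0 by case: K0 => z Kz; exists ((a - a') *: z + 0), z.
have C0 : comb K (reflect_body K) a' b !=set0.
  by case: K0 => z Kz; exists (a' *: z + b *: - z), z => //; exists (- z) => //; exists z.
have vC : convex_set (comb K (reflect_body K) a' b).
  apply: convex_setI01 => _ _ s [x Kx [_ [y Ky <-] <-]] [x' Kx' [_ [y' Ky' <-] <-]] s0 s1.
  exists (s *: x + (1 - s) *: x'); first exact: convex_setE.
  exists (- (s *: y + (1 - s) *: y')).
    by exists (s *: y + (1 - s) *: y') => //; exact: convex_setE.
  by apply: plane_eq; rewrite /= /GRing.scale/=; ring.
have Cbig : comb K (reflect_body K) a' b `<=` big.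
  move=> _ [x Kx [_ [y Ky <-] <-]]; have [k Kk ->] := Kt y Ky.
  have [|w Kw wE] := @convex_combD K a' (2 * b) x k vK Kx Kk a'0.
    by rewrite mulr_ge0.
  by exists w => //; rewrite -wE scalerDr addrA scalerA mulrC.
(* Adding [dil] = (a - a') K to a' K - b K yields a set containing a K - b K, while adding it to
   [big] stays in a translate of (a + 2 b) K. *)
have := vol_minkowski_mono cdil dil0 C0 (cC a') vC cbig Cbig.
rewrite {1}/big vol_homothety//.
have h1 : vol (comb K (reflect_body K) a b) <=
    vol (minkowski_sum (comb K (reflect_body K) a' b) dil).
  apply: vol_le => //; first exact: compact_minkowski_sum.
  move=> _ [x Kx [y Ky <-]]; exists (a' *: x + b *: y).
    by exists x => //; exists y.
  exists ((a - a') *: x + 0); first by exists x.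
  by rewrite addr0 addrAC -scalerDl [a' + _]addrC subrK.
have h2 : vol (minkowski_sum big dil) <= (a + 2 * b) ^+ 2 * vol K.
  rewrite -(vol_homothety (a + 2 * b) (b *: t))//.
  apply: vol_le; [exact: compact_minkowski_sum|exact: compact_homothety|].
  move=> _ [_ [z Kz <-] [_ [y Ky <-] <-]].
  have [||w Kw wE] := @convex_combD K (a' + 2 * b) (a - a') z y vK Kz Ky.
  - by rewrite addr_ge0// mulr_ge0.
  - by rewrite subr_ge0.
  exists w => //; rewrite addr0 addrAC wE; congr (_ *: _ + _); ring.
move=> h; apply: (le_trans (lerD h1 (lexx _))); apply: (le_trans h).
by rewrite lerD2r.
Qed.

End DilatedDifference.

(** * The positive quadrant of the l_q ball and its boundary curve *)

Section ConjugateBall.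
Context {R : realType}.
Variable p : R.
Hypothesis p_gt1 : 1 < p.

Definition conjugate : R := p / (p - 1).
Local Notation q := conjugate.

Let p_gt0 : 0 < p. Proof. exact: lt_trans p_gt1. Qed.
Let p_neq0 : p != 0. Proof. by rewrite gt_eqF. Qed.
Let p1_gt0 : 0 < p - 1. Proof. by rewrite subr_gt0. Qed.
Let p1_neq0 : p - 1 != 0. Proof. by rewrite gt_eqF. Qed.

Let one_powR (x : R) : 1 `^ x = 1. Proof. by rewrite powR1. Qed.

Lemma conjugate_gt0 : 0 < q. Proof. by rewrite divr_gt0. Qed.
Let q_gt0 := conjugate_gt0.

Lemma conjugate_inv : p^-1 + q^-1 = 1.
Proof. by rewrite /q invf_div; field. Qed.

Lemma conjugateBM : (q - 1) * p = q.
Proof. by rewrite /q; field. Qed.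

Lemma mulr_subr1_conjugate : (p - 1) * q = p.
Proof. by rewrite /q; field. Qed.

(* The positive part of the unit ball of l_q, as the polar of that of l_p. *)
Definition lq_ball : set (R * R) :=
  [set c | [/\ 0 <= c.1, 0 <= c.2 & forall s t, 0 <= s -> 0 <= t ->
    c.1 * s + c.2 * t <= (s `^ p + t `^ p) `^ p^-1]].

(** One direction is Hölder's inequality. For the other, testing at s = a^(q-1), t = b^(q-1) gives S
    <= S^(1/p), which excludes S > 1. *)
Lemma lq_ballP (a b : R) : 0 <= a -> 0 <= b ->
  lq_ball (a, b) <-> a `^ q + b `^ q <= 1.
Proof.
move=> a0 b0; set S := a `^ q + b `^ q; have S0 : 0 <= S by rewrite addr_ge0 ?powR_ge0.
split=> [[/= _ _]|S1].
  move=> /(_ _ _ (powR_ge0 a (q - 1)) (powR_ge0 b (q - 1))).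
  rewrite !mulr_powRB1// -!powRrM conjugateBM -/S => SS.
  have : S `^ p <= S.
    rewrite -[leRHS](powRr1 S0) -(mulVf p_neq0) powRrM.
    by apply: ge0_ler_powR => //; rewrite ?nnegrE ?powR_ge0// ltW.
  apply: contraTT; rewrite -!ltNge => S1.
  have S_gt0 : 0 < S by exact: lt_trans S1.
  rewrite -(@mulr_powRB1 _ S p)// ltr_pMr// -[ltLHS](one_powR (p - 1)).
  by apply: gt0_ltr_powR => //; rewrite nnegrE.
split => //= s t s0 t0.
have := @hoelder2 _ a b s t q p a0 b0 s0 t0 q_gt0 p_gt0.
rewrite addrC conjugate_inv => /(_ erefl) /le_trans; apply.
rewrite -[leRHS]mul1r; apply: ler_wpM2r; first exact: powR_ge0.
rewrite -[leRHS](one_powR q^-1); apply: ge0_ler_powR => //.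
- by rewrite invr_ge0 ltW.
- by rewrite nnegrE.
Qed.

(** The equality case of Hölder's inequality: the maximiser is (h^(p-1), h'^(p-1)) divided by
    S^(1/q), or the origin when S = 0. *)
Lemma lq_ball_extremal (h h' : R) : 0 <= h -> 0 <= h' ->
  exists2 c, lq_ball c & c.1 * h + c.2 * h' = (h `^ p + h' `^ p) `^ p^-1.
Proof.
move=> h0 h'0; set S := h `^ p + h' `^ p.
have S0 : 0 <= S by rewrite addr_ge0 ?powR_ge0.
have [S_eq0|S_neq0] := eqVneq S 0.
  move: (S_eq0) => /eqP; rewrite paddr_eq0 ?powR_ge0// !powR_eq0 p_neq0 !andbT.
  move=> /andP[/eqP-> /eqP->]; exists (0, 0); last first.
    by rewrite !mulr0 addr0 S_eq0 powR0// invr_eq0.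
  by split => //= s t _ _; rewrite !mul0r addr0 powR_ge0.
have Sq_neq0 : S `^ q^-1 != 0 by rewrite powR_eq0 (negbTE S_neq0).
exists (h `^ (p - 1) / S `^ q^-1, h' `^ (p - 1) / S `^ q^-1) => /=.
  apply/lq_ballP; rewrite ?divr_ge0 ?powR_ge0//.
  have powq (x : R) : 0 <= x -> (x `^ (p - 1) / S `^ q^-1) `^ q = x `^ p / S.
    move=> x0; rewrite powRM ?powR_ge0 ?invr_ge0 ?powR_ge0// -powRrM.
    rewrite mulr_subr1_conjugate -powRN -powRrM mulNr mulVf ?gt_eqF//.
    by rewrite powR_inv1.
  by rewrite !powq// -mulrDl divff.
rewrite ![_ / _ * _]mulrAC -mulrDl ![_ * h]mulrC ![_ * h']mulrC !mulr_powRB1//.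
apply: (mulIf Sq_neq0); rewrite divfK// -powRD ?conjugate_inv ?powRr1//.
by rewrite oner_eq0.
Qed.

Lemma lq_ball_le1 c : lq_ball c -> c.1 <= 1 /\ c.2 <= 1.
Proof.
case=> c1 c2 h; split.
  by have := h 1 0 ler01 (lexx _); rewrite mulr1 mulr0 addr0 powR1 powR0// addr0 powR1.
by have := h 0 1 (lexx _) ler01; rewrite mulr1 mulr0 add0r powR1 powR0// add0r powR1.
Qed.

(** The polar form makes the ball an intersection of half-planes, from which convexity and
    closedness are read off. *)
Lemma convex_lq_ball : convex_set lq_ball.
Proof.
apply: convex_setI01 => x y t [x1 x2 hx] [y1 y2 hy] t0 t1.
have t'0 : 0 <= 1 - t by rewrite subr_ge0.
split => /= [||r s r0 s0]; rewrite ?addr_ge0 ?mulr_ge0//.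
have := lerD (ler_wpM2l t0 (hx r s r0 s0)) (ler_wpM2l t'0 (hy r s r0 s0)).
rewrite -mulrDl [t + _]addrC subrK mul1r; apply: le_trans.
by rewrite le_eqVlt /GRing.scale/=; apply/orP; left; apply/eqP; ring.
Qed.

Lemma compact_lq_ball : compact lq_ball.
Proof.
rewrite (_ : lq_ball = `[0, 1] `*` `[0, 1] `&` lq_ball); last first.
  rewrite setIidr// => c Bc; have [h1 h2] := lq_ball_le1 Bc; case: Bc => c1 c2 _.
  by split; rewrite /= in_itv/= ?c1 ?c2.
apply: compact_closedI; first by apply: compact_setX; exact: segment_compact.
rewrite (_ : lq_ball = [set c | dot c (-1, 0) <= 0] `&` [set c | dot c (0, -1) <= 0]
  `&` \bigcap_(u in [set u : R * R | 0 <= u.1 /\ 0 <= u.2])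
    [set c | dot c u <= (u.1 `^ p + u.2 `^ p) `^ p^-1]).
  apply: closedI; first by apply: closedI; exact: closed_halfplane.
  by apply: closed_bigI => u _; exact: closed_halfplane.
apply/seteqP; split => c.
  case=> c1 c2 h; split; last by move=> u [u1 u2]; exact: h.
  by split; rewrite /= /dot/= ?mulrN1 ?mulr0 ?addr0 ?add0r oppr_le0.
case=> -[]; rewrite /= /dot/= !mulrN1 !mulr0 addr0 add0r !oppr_le0 => c1 c2 h.
by split => // s t s0 t0; exact: (h (s, t)).
Qed.

Definition lq_curve (a : R) : R := (1 - a `^ q) `^ q^-1.

Let lq_curve_powR (a : R) : 0 <= a -> a <= 1 -> lq_curve a `^ q = 1 - a `^ q.
Proof.
move=> a0 a1; rewrite /lq_curve -powRrM mulVf ?gt_eqF// powRr1//.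
rewrite subr_ge0 -[leRHS](one_powR q); by apply: ge0_ler_powR; rewrite ?nnegrE// ltW.
Qed.

Lemma lq_curve0 : lq_curve 0 = 1.
Proof. by rewrite /lq_curve powR0 ?gt_eqF// subr0 powR1. Qed.

Lemma lq_curve_ge0 (a : R) : 0 <= lq_curve a.
Proof. exact: powR_ge0. Qed.

Lemma lq_ball_curve (a : R) : 0 <= a -> a <= 1 -> lq_ball (a, lq_curve a).
Proof.
move=> a0 a1; apply/lq_ballP => //; first exact: lq_curve_ge0.
by rewrite lq_curve_powR// addrC subrK.
Qed.

Lemma lq_ball_le_curve (a b : R) : lq_ball (a, b) -> b <= lq_curve a.
Proof.
move=> Bab; case: (Bab) => /= a0 b0 _.
have [/= a1 b1] := lq_ball_le1 Bab.
move: Bab => /(lq_ballP a0 b0); rewrite leNgt; apply: contraNle => h.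
rewrite -(ltrBDl) -lq_curve_powR//; apply: gt0_ltr_powR => //.
by rewrite nnegrE lq_curve_ge0.
Qed.

Lemma lq_curve_le1 (a : R) : 0 <= a -> a <= 1 -> lq_curve a <= 1.
Proof. by move=> a0 a1; have [] := lq_ball_le1 (lq_ball_curve a0 a1). Qed.

(** Lowering a coordinate to a nonnegative value stays in the ball, so [(a, lq_curve b)] is in it
    and hence below the curve. *)
Lemma lq_curve_decreasing (a b : R) : 0 <= a -> a <= b -> b <= 1 ->
  lq_curve b <= lq_curve a.
Proof.
move=> a0 ab b1; have b0 := le_trans a0 ab; apply: lq_ball_le_curve.
have [/= _ cb h] := lq_ball_curve b0 b1; split => //= s t s0 t0.
by apply: le_trans (h s t s0 t0); rewrite lerD2r ler_wpM2r.
Qed.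

End ConjugateBall.

(** * The p-sum as a union of Minkowski combinations *)

Section PSum.
Context {R : realType}.
Implicit Types (K L M : set (R * R)) (x y z u : R * R).

Lemma support_fun_attained K u : K !=set0 -> compact K ->
  exists2 x, K x & support_fun K u = dot x u.
Proof.
move=> K0 cK.
have [x /set_mem Kx xmax] : exists2 x, x \in K &
    forall y, y \in K -> dot y u <= dot x u.
  by apply: compact_EVT_max => //; apply: continuous_subspaceT; exact: continuous_dot.
exists x => //; apply/eqP; rewrite eq_le /support_fun; apply/andP; split.
  apply: sup_le_ub; first by exists (dot x u), x.
  by move=> _ [y Ky <-]; apply: xmax; rewrite inE.
apply: ub_le_sup; last by exists x.
by exists (dot x u) => _ [y Ky <-]; apply: xmax; rewrite inE.
Qed.

Lemma dot_le_support_fun K x u : compact K -> K x -> dot x u <= support_fun K u.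
Proof.
move=> cK Kx; apply: ub_le_sup; last by exists x.
have [||y Ky ymax] := @compact_EVT_max _ R (fun x => dot x u) K _ cK.
- by exists x.
- by apply: continuous_subspaceT; exact: continuous_dot.
by exists (dot y u) => _ [z Kz <-]; apply: ymax; rewrite inE.
Qed.

Lemma support_fun_ge0 K u : compact K -> K (0, 0) -> 0 <= support_fun K u.
Proof.
move=> cK K0; apply: le_trans (dot_le_support_fun u cK K0).
by rewrite /dot/= !mul0r addr0.
Qed.

(** A point of [M] outside [N] would be separated from [N], and the support functions would be in
    the wrong order at the separating normal. *)
Lemma sub_convex_body M N : convex_body M -> convex_body N ->
  (forall u, support_fun M u <= support_fun N u) -> M `<=` N.
Proof.
move=> [_ cM _] [N0 cN vN] MN z Mz; apply: contrapT => /(separation N0 cN vN).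
move=> [u [c [Nc cz]]]; have [x Nx hx] := support_fun_attained u N0 cN.
have := le_trans (dot_le_support_fun u cM Mz) (MN u).
by rewrite hx leNgt (le_lt_trans (Nc x Nx)).
Qed.

(* The p-sum as a union of ordinary Minkowski combinations. *)
Definition psum_set (p : R) K L : set (R * R) :=
  [set z | exists2 c, lq_ball p c & comb K L c.1 c.2 z].

(** Compactness: it is a continuous image of [lq_ball p], [K] and [L]. Convexity: average the
    coefficients in the ball and merge points by [convex_combD]. Support function: maximising c.1
    h_K + c.2 h_L over the ball gives the l_p norm of (h_K, h_L), by polarity for the upper bound
    and [lq_ball_extremal] for the lower one. *)
Lemma psum_set_is_psum (p : R) K L : 1 < p -> convex_body K -> convex_body L ->
  K (0, 0) -> L (0, 0) -> is_psum p K L (psum_set p K L).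
Proof.
move=> p1 [Kn0 cK vK] [Ln0 cL vL] K0 L0.
have cN : compact (psum_set p K L).
  rewrite (_ : psum_set p K L =
      (fun v : (R * R) * ((R * R) * (R * R)) => v.1.1 *: v.2.1 + v.1.2 *: v.2.2)
      @` (lq_ball p `*` (K `*` L))); last first.
    apply/seteqP; split => [z [c Bc [x Kx [y Ly <-]]]|_ [[c [x y]] /= [Bc [Kx Ly]] <-]].
      by exists (c, (x, y)).
    by exists c => //; exists x => //; exists y.
  apply: continuous_compact; last first.
    by apply: compact_setX; [exact: compact_lq_ball|exact: compact_setX].
  have cZ (T : topologicalType) (k : T -> R) (g : T -> R * R) :
      continuous k -> continuous g -> continuous (fun v => k v *: g v).
    by move=> ck cg v; apply: cvgZ; [exact: ck|exact: cg].
  have c1 (T U : topologicalType) (g : T -> U * U) : continuous g ->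
      continuous (fun v => (g v).1) /\ continuous (fun v => (g v).2).
    move=> cg; split=> v.
      by apply: (@cvg_comp _ _ _ g fst); [exact: cg|exact: cvg_fst].
    by apply: (@cvg_comp _ _ _ g snd); [exact: cg|exact: cvg_snd].
  have [k1 k2] := c1 ((R * R) * ((R * R) * (R * R)))%type R fst
    (fun v => @cvg_fst _ _ _ _ _).
  have [g1 g2] := c1 ((R * R) * ((R * R) * (R * R)))%type (R * R)%type snd
    (fun v => @cvg_snd _ _ _ _ _).
  apply: continuous_subspaceT => v.
  by apply: cvgD; [exact: (cZ _ _ _ k1 g1)|exact: (cZ _ _ _ k2 g2)].
have N0 : psum_set p K L !=set0.
  exists (0 *: (0, 0) + 0 *: (0, 0)); exists (0, 0).
    by split => //= s t _ _; rewrite !mul0r addr0 powR_ge0.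
  by exists (0, 0) => //; exists (0, 0).
split.
  split => //; apply: convex_setI01 => _ _ t [c Bc [x Kx [y Ly <-]]]
    [c' Bc' [x' Kx' [y' Ly' <-]]] t0 t1.
  have t'0 : 0 <= 1 - t by rewrite subr_ge0.
  have [[c1 c2 _] [c'1 c'2 _]] := (Bc, Bc').
  exists (t *: c + (1 - t) *: c').
    by apply: convex_setE => //; exact: convex_lq_ball.
  have [||w Kw wE] := @convex_combD _ K (t * c.1) ((1 - t) * c'.1) x x' vK Kx Kx'.
  - by rewrite mulr_ge0.
  - by rewrite mulr_ge0.
  have [||w' Lw' w'E] := @convex_combD _ L (t * c.2) ((1 - t) * c'.2) y y' vL Ly Ly'.
  - by rewrite mulr_ge0.
  - by rewrite mulr_ge0.
  exists w => //; exists w' => //.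
  rewrite -[(_ + _).1]/(t * c.1 + (1 - t) * c'.1) -wE.
  rewrite -[(_ + _).2]/(t * c.2 + (1 - t) * c'.2) -w'E.
  by rewrite !scalerDr !scalerA addrACA.
move=> u; apply/eqP; rewrite eq_le; apply/andP; split.
  have [_ [c [c1 c2 Bc] [x Kx [y Ly <-]]] ->] := support_fun_attained u N0 cN.
  rewrite dotDl !dotZl.
  apply: le_trans (Bc _ _ (support_fun_ge0 u cK K0) (support_fun_ge0 u cL L0)).
  by rewrite lerD// ler_wpM2l// dot_le_support_fun.
have [c Bc <-] := lq_ball_extremal p1 (support_fun_ge0 u cK K0)
  (support_fun_ge0 u cL L0).
have [x Kx ->] := support_fun_attained u Kn0 cK.
have [y Ly ->] := support_fun_attained u Ln0 cL.
rewrite -!dotZl -dotDl; apply: dot_le_support_fun => //.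
by exists c => //; exists x => //; exists y.
Qed.

Lemma convex_body_reflect K : convex_body K -> convex_body (reflect_body K).
Proof.
move=> [[x Kx] cK vK]; split; [by exists (- x), x|exact: compact_reflect_body|].
apply: convex_setI01 => _ _ t [y Ky <-] [z Kz <-] t0 t1.
exists (t *: y + (1 - t) *: z); first exact: convex_setE.
by rewrite opprD !scalerN.
Qed.

(** Dilates of a convex set containing the origin increase with the factor. *)
Lemma comb_le K L (a b a' b' : R) : convex_set K -> convex_set L ->
  K (0, 0) -> L (0, 0) -> 0 <= a -> a <= a' -> 0 <= b -> b <= b' ->
  comb K L a b `<=` comb K L a' b'.
Proof.
move=> vK vL K0 L0 a0 aa b0 bb _ [x Kx [y Ly <-]].
have aa0 : 0 <= a' - a by rewrite subr_ge0.
have bb0 : 0 <= b' - b by rewrite subr_ge0.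
have [w Kw wE] := @convex_combD _ K a (a' - a) x (0, 0) vK Kx K0 a0 aa0.
have [v Lv vE] := @convex_combD _ L b (b' - b) y (0, 0) vL Ly L0 b0 bb0.
have zE (c : R) : c *: ((0, 0) : R * R) = 0 by exact: scaler0.
rewrite zE addr0 addrC subrK in wE; rewrite zE addr0 addrC subrK in vE.
by exists w => //; exists v => //; rewrite wE vE.
Qed.

(** * The staircase estimate for the area of K +_p (-K) *)

Section UpperBound.
Variables (p : R) (K : set (R * R)).
Hypotheses (p_gt1 : 1 < p) (bK : convex_body K) (K0 : K (0, 0)).

Local Notation L := (reflect_body K).
Local Notation f := (lq_curve p).
Local Notation grid n i := (i%:R / n.+1%:R : R).

Let cK : compact K. Proof. by case: bK. Qed.
Let vK : convex_set K. Proof. by case: bK. Qed.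
Let Kn0 : K !=set0. Proof. by case: bK. Qed.
Let cL : compact L. Proof. exact: compact_reflect_body. Qed.
Let vL : convex_set L. Proof. by case: (convex_body_reflect bK). Qed.
Let L0 : L (0, 0). Proof. by exists (0, 0) => //; exact: oppr0. Qed.

(** The body at the outer corner of the staircase above the i-th cell of the grid. *)
Let piece n i := comb K L (grid n i.+1) (f (grid n i)).

Let grid_ge0 n i : 0 <= grid n i.
Proof. by rewrite divr_ge0. Qed.

Let grid_le n i j : (i <= j)%N -> grid n i <= grid n j.
Proof. by move=> ij; rewrite ler_pM2r ?invr_gt0// ler_nat. Qed.

Let grid_le1 n i : (i <= n.+1)%N -> grid n i <= 1.
Proof. by move=> ij; rewrite ler_pdivrMr// mul1r ler_nat. Qed.

Let compact_piece n i : compact (piece n i).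
Proof. exact: compact_comb. Qed.

Let gridS n i : grid n i.+1 = grid n i + n.+1%:R^-1.
Proof. by rewrite -addn1 natrD mulrDl mul1r. Qed.

(** This is the step from an inner corner to the next outer one. Expanding the squares in
    [vol_comb_increment] leaves a part that telescopes over the grid and a term of a Riemann sum of
    [f]. *)
Let vol_piece n i : vol (piece n i) <= vol (comb K L (grid n i) (f (grid n i))) +
  (grid n i.+1 ^+ 2 - grid n i ^+ 2 + 4 * (f (grid n i) / n.+1%:R)) * vol K.
Proof.
have := @vol_comb_increment _ K (grid n i.+1) (grid n i) (f (grid n i)) Kn0 cK vK
  (grid_ge0 n i) (grid_le n (leqnSn i)) (lq_curve_ge0 p _).
rewrite -/(piece n i) -lerBrDr => /le_trans; apply.
rewrite [X in X - _]addrC -addrA lerD2l -mulrBl.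
apply: ler_wpM2r; first exact: vol_ge0.
by rewrite gridS le_eqVlt; apply/orP; left; apply/eqP; ring.
Qed.

Let pieces n m := \bigcup_(i in `I_m.+1) piece n i.

Let piecesS n m : pieces n m.+1 = pieces n m `|` piece n m.+1.
Proof. by rewrite /pieces IIS bigcup_setU bigcup_set1. Qed.

Let pieces0 n : pieces n 0 = piece n 0.
Proof. by rewrite /pieces IIS II0 set0U bigcup_set1. Qed.

Let compact_pieces n m : compact (pieces n m).
Proof.
elim: m => [|m IH]; first by rewrite pieces0; exact: compact_piece.
by rewrite piecesS; apply: compactU => //; exact: compact_piece.
Qed.

(* Consecutive pieces overlap in at least [comb K L (grid n m.+1) (f (grid n m.+1))],
   so that the union telescopes. *)
Let vol_pieces n m : (m <= n)%N -> vol (pieces n m) <=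
  (1 + grid n m.+1 ^+ 2 + 4 * \sum_(i < m.+1) (f (grid n i) / n.+1%:R)) * vol K.
Proof.
elim: m => [_|m IH mn].
  rewrite pieces0; apply: (le_trans (vol_piece n 0)).
  rewrite big_ord_recl big_ord0 addr0 -lerBrDr -mulrBl /=.
  (* The staircase starts at the corner (0, 1), whose body is -K; its area accounts for the summand
     1. *)
  have -> : comb K L (grid n 0) (f (grid n 0)) = [set 1 *: z + 0 | z in L].
    rewrite mul0r lq_curve0//; apply/seteqP; split=> [_ [x Kx [y Ly <-]]|_ [y Ly <-]].
      by exists y => //; rewrite scale0r add0r addr0.
    by exists (0, 0) => //; exists y => //; rewrite scale0r add0r addr0.
  rewrite vol_homothety// expr1n mul1r.
  have -> : vol L = vol K.
    transitivity ((-1) ^+ 2 * vol K); last by rewrite sqrrN expr1n mul1r.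
    rewrite -(vol_homothety (-1) 0 cK).
    congr vol; apply/seteqP; split=> [_ [y Ky <-]|_ [y Ky <-]].
      by exists y => //; rewrite scaleN1r addr0.
    by exists y => //; rewrite scaleN1r addr0.
  rewrite -[leLHS]mul1r; apply: ler_wpM2r; first exact: vol_ge0.
  by rewrite mul0r expr0n/= subr0 -[1 + _ + _]addrA addrK.
have {}IH := IH (ltnW mn).
rewrite piecesS (vol_setU (@compact_pieces n m) (@compact_piece n m.+1)).
have h1 := vol_piece n m.+1.
have h2 : vol (comb K L (grid n m.+1) (f (grid n m.+1))) <=
    vol (pieces n m `&` piece n m.+1).
  apply: vol_le; first exact: compact_comb.
    apply: compact_closedI => //; apply: (compact_closed (@norm_hausdorff _ _)).
    exact: compact_piece.
  have g0 := grid_ge0 n; have fg0 i := lq_curve_ge0 p (grid n i).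
  move=> z h; split.
    exists m => /=; first by rewrite ltnS.
    apply: (comb_le vK vL K0 L0 (g0 _) (lexx _) (fg0 _) _ h).
    apply: (lq_curve_decreasing p_gt1 (g0 _) (grid_le n (leqnSn m))).
    by apply: grid_le1; exact: (ltnW mn).
  exact: (comb_le vK vL K0 L0 (g0 _) (grid_le n (leqnSn _)) (fg0 _) (lexx _) h).
rewrite big_ord_recr /=.
move: h1 h2 IH.
move: (vol (pieces n m `&` _)) (vol (comb _ _ _ _)) (vol (piece _ _)) (vol (pieces n m)).
move: (\sum_(i < m.+1) _) => S; move: (f _ / _) => c.
move: (vol K) (_ / _) (_ / _) => V g g'.
by move=> A B C D h1 h2 h3; lra.
Qed.

(** If [a] lies in the i-th cell, then [b <= f a <= f (grid n i)], so [(a, b)] is dominated by the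
    i-th outer corner. *)
Let psum_sub_pieces n : psum_set p K L `<=` pieces n n.
Proof.
move=> z [[a b] Bab]; case: (Bab) => /= a0 b0 _.
have [/= a1 b1] := lq_ball_le1 p_gt1 Bab.
have [i [ilt ia ai]] : exists i, [/\ (i <= n)%N, grid n i <= a & a <= grid n i.+1].
  (* At [a = 1] truncation would return the index [n.+1], one too many. *)
  have [a_eq1|a_neq1] := eqVneq a 1.
    exists n; split => //; first by rewrite a_eq1; exact: grid_le1.
    by rewrite a_eq1 divff// pnatr_eq0.
  have a_lt1 : a < 1 by rewrite lt_neqAle a_neq1.
  have an0 : 0 <= a * n.+1%:R by rewrite mulr_ge0.
  have /andP[h1 h2] := truncn_itv an0.
  exists (Num.truncn (a * n.+1%:R)); split.
  - rewrite -ltnS -(ltr_nat R); apply: le_lt_trans h1 _.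
    by rewrite gtr_pMl.
  - by rewrite ler_pdivrMr.
  - by rewrite ler_pdivlMr// ltW.
move=> h; exists i; first by rewrite /= ltnS.
apply: (comb_le vK vL K0 L0 a0 ai b0 _ h).
apply: le_trans (lq_ball_le_curve p_gt1 Bab) _.
exact: (lq_curve_decreasing p_gt1 (grid_ge0 n i) ia a1).
Qed.

(** [J] is later the integral of [f] over [0, 1]. The staircase bound then has an error of order 1 /
    (n + 1), which vanishes in the limit. *)
Lemma vol_psum_le (M : set (R * R)) (J : R) : is_psum p K L M ->
  (forall n, \sum_(i < n.+1) (f (grid n i) / n.+1%:R) <= J + n.+1%:R^-1) ->
  vol M <= (2 + 4 * J) * vol K.
Proof.
move=> [bM MS] hJ.
have [bN NS] := psum_set_is_psum p_gt1 bK (convex_body_reflect bK) K0 L0.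
have MN : M `<=` psum_set p K L.
  by apply: sub_convex_body => // u; rewrite MS NS.
have cM : compact M by case: bM.
have h n : vol M <= (2 + 4 * J) * vol K + 4 * vol K * n.+1%:R^-1.
  apply: (@le_trans _ _ (vol (pieces n n))).
    apply: vol_le => // z /MN; exact: psum_sub_pieces.
  apply: (le_trans (vol_pieces (leqnn n))).
  rewrite mulrAC -mulrDl; apply: ler_wpM2r; first exact: vol_ge0.
  have -> : grid n n.+1 = 1 by rewrite divff// pnatr_eq0.
  move: (hJ n); rewrite expr1n; set S := \sum_(i < n.+1) _.
  by move: S => S; move: n.+1%:R^-1 => e; lra.
apply/ler_addgt0Pr => e; rewrite -[e]/(e : R) => e0.
have [n ne] : exists n, 4 * vol K * n.+1%:R^-1 <= e.
  exists (Num.truncn (4 * vol K / e)).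
  rewrite ler_pdivrMr// -ler_pdivrMl// [e^-1 * _]mulrC.
  have h0 : 0 <= 4 * vol K / e by rewrite divr_ge0 ?mulr_ge0 ?vol_ge0// ltW.
  by have /andP[_ /ltW] := truncn_itv h0.
by apply: (le_trans (h n)); rewrite lerD2l.
Qed.

End UpperBound.
End PSum.

(** * The area under the l_q curve: Riemann sums and primitive *)

Section AreaUnderCurve.
Context {R : realType}.
Variable p : R.
Hypothesis p_gt1 : 1 < p.

Local Notation q := (conjugate p).
Local Notation f := (lq_curve p).
Local Notation leb := (@lebesgue_measure R).

Lemma measurable_lq_curve :
  measurable_fun [set: R] (f : R -> R).
Proof.
apply: (@measurableT_comp _ _ _ _ _ _ (fun x => x `^ q^-1) _ (fun a => 1 - a `^ q)).
  exact: measurable_powR.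
by apply: measurable_funB => //; exact: measurable_powR.
Qed.

Lemma integrable_lq_curve (A : set R) : measurable A -> A `<=` `[0, 1] ->
  leb.-integrable A (EFin \o f).
Proof.
move=> mA A01; apply: measurable_bounded_integrable => //.
- apply: (@le_lt_trans _ _ (leb `[0, 1])).
    by apply: le_measure => //; rewrite inE.
  by rewrite lebesgue_measure_itv/= lte01 oppr0 adde0 ltry.
- by apply: (@measurable_funS _ _ _ _ setT) => //; exact: measurable_lq_curve.
- exists 1; split => // M M1 x /A01; rewrite /= in_itv/= => /andP[x0 x1].
  rewrite ger0_norm ?lq_curve_ge0//; apply: le_trans (ltW M1).
  exact: lq_curve_le1.
Qed.

Definition lq_primitive (x : R) : R := \int[leb]_(t in `[0, x]) f t.
Local Notation G := lq_primitive.

Lemma lq_primitive0 : G 0 = 0.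
Proof. by rewrite /lq_primitive set_itv1 Rintegral_set1. Qed.

Let G_incr (a b : R) : 0 <= a -> a <= b -> b <= 1 ->
  G b - G a = \int[leb]_(t in `]a, b]) f t.
Proof.
move=> a0 ab b1; apply: Rintegral_itvB; rewrite ?bnd_simp//.
by apply: integrable_lq_curve => //; apply: subset_itvl; rewrite bnd_simp.
Qed.

Let sub01 (a b : R) : 0 <= a -> b <= 1 -> `]a, b] `<=` `[0, 1].
Proof.
move=> a0 b1 x /=; rewrite !in_itv/= => /andP[/ltW ax xb].
by rewrite (le_trans a0 ax) (le_trans xb b1).
Qed.

Let int_cst (a b c : R) : a <= b -> \int[leb]_(t in `]a, b]) c = (b - a) * c.
Proof.
move=> ab; rewrite Rintegral_cst//= lebesgue_measure_itv/= lte_fin.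
case: ltgtP ab => //= [ab _|-> _]; first by rewrite mulrC.
by rewrite subrr mul0r mulr0.
Qed.

Let integrable_cst (a b c : R) : leb.-integrable `]a, b] (EFin \o cst c).
Proof.
apply: measurable_bounded_integrable => //.
  by rewrite /= lebesgue_measure_itv/=; case: ifPn => _; rewrite ?ltry.
exists `|c|; split; first exact: num_real.
by move=> M /ltW cM x _.
Qed.

Lemma lq_primitive_ge (a b : R) : 0 <= a -> a <= b -> b <= 1 ->
  (b - a) * f b <= G b - G a.
Proof.
move=> a0 ab b1; rewrite (G_incr a0 ab b1) -(int_cst (f b) ab).
apply: le_Rintegral; first exact: measurable_itv.
- exact: integrable_cst.
- by apply: integrable_lq_curve; [exact: measurable_itv|exact: sub01].
move=> x /=; rewrite in_itv/= => /andP[/ltW ax xb].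
by apply: lq_curve_decreasing => //; exact: le_trans ax.
Qed.

Lemma lq_primitive_le (a b : R) : 0 <= a -> a <= b -> b <= 1 ->
  G b - G a <= b - a.
Proof.
move=> a0 ab b1; rewrite (G_incr a0 ab b1) -[leRHS]mulr1 -(int_cst 1 ab).
apply: le_Rintegral; first exact: measurable_itv.
- by apply: integrable_lq_curve; [exact: measurable_itv|exact: sub01].
- exact: integrable_cst.
move=> x /=; rewrite in_itv/= => /andP[/ltW ax xb].
by apply: lq_curve_le1 => //; [exact: le_trans ax|exact: le_trans b1].
Qed.

(** As [f] is decreasing, each term with i >= 1 is at most the integral over the cell to its left;
    the term i = 0 is the error [n.+1%:R^-1]. *)
Lemma lq_riemann_sum n :
  \sum_(i < n.+1) (f (i%:R / n.+1%:R) / n.+1%:R) <= G 1 + n.+1%:R^-1.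
Proof.
suff h m : (m <= n)%N -> \sum_(i < m.+1) (f (i%:R / n.+1%:R) / n.+1%:R) <=
    G (m%:R / n.+1%:R) + n.+1%:R^-1.
  apply: (le_trans (h n (leqnn n))); rewrite lerD2r -subr_ge0.
  have n1 : n%:R / n.+1%:R <= 1 :> R by rewrite ler_pdivrMr// mul1r ler_nat.
  apply: le_trans (lq_primitive_ge _ n1 (lexx _)); last by rewrite divr_ge0.
  by rewrite mulr_ge0 ?subr_ge0// lq_curve_ge0.
elim: m => [_|m IH mn].
  by rewrite big_ord_recl big_ord0 /= mul0r lq_curve0// lq_primitive0 add0r addr0 mul1r.
rewrite big_ord_recr /=; apply: (le_trans (lerD (IH (ltnW mn)) (lexx _))).
rewrite addrAC lerD2r -lerBrDl.
have m0 : 0 <= m%:R / n.+1%:R :> R by rewrite divr_ge0.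
have mm : m%:R / n.+1%:R <= m.+1%:R / n.+1%:R :> R.
  by rewrite ler_pM2r ?invr_gt0// ler_nat.
have m1 : m.+1%:R / n.+1%:R <= 1 :> R by rewrite ler_pdivrMr// mul1r ler_nat ltnW.
apply: le_trans (lq_primitive_ge m0 mm m1).
by rewrite -mulrBl -natrB// subSnn mul1r mulrC.
Qed.

Lemma is_derive_lq_primitive (x : R) : 0 < x -> x < 1 -> is_derive x 1 G (f x).
Proof.
move=> x0 x1; have q0 := conjugate_gt0 p_gt1.
have xq : 0 < 1 - x `^ q.
  rewrite subr_gt0 -[ltRHS](_ : 1 `^ q = 1); last by rewrite powR1.
  by apply: gt0_ltr_powR; rewrite ?nnegrE// ltW.
have cf : {for x, continuous f}.
  have d1 : is_derive x 1 (fun x : R => 1 - x `^ q) (0 - q * x `^ (q - 1)).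
    by apply: is_deriveB; exact: is_derive1_powR.
  have := @is_derive1_comp _ (fun y => y `^ q^-1) (fun x => 1 - x `^ q) x _ _
    (is_derive1_powR q^-1 xq) d1.
  by move=> /@ex_derive /derivable1_diffP /differentiable_continuous.
have [||//|d1 d2] := @continuous_FTC1_closed _ f 0 x 1 x1.
- by apply: integrable_lq_curve.
- exact: x0.
apply: DeriveDef; first exact: d1.
by rewrite -derive1E.
Qed.

End AreaUnderCurve.

(** * The area under the l_q curve as the trigonometric integral *)

Section TrigonometricIntegral.
Context {R : realType}.
Variable p : R.
Hypothesis p_gt1 : 1 < p.

Local Notation q := (conjugate p).
Local Notation f := (lq_curve p).
Local Notation G := (lq_primitive p).
Local Notation leb := (@lebesgue_measure R).

Let q_gt0 : 0 < q. Proof. exact: conjugate_gt0. Qed.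
Let p1_gt0 : 0 < p - 1. Proof. by rewrite subr_gt0. Qed.

(* The curve x^q + y^q = 1 parametrised by the slope w = x / y. *)
Let Y (w : R) := (1 + w `^ q) `^ (- q^-1).
Let X (w : R) := w * Y w.
(** Twice the area of the sector of the ball between the vertical axis and the ray through (X w, Y
    w): twice the area under the curve minus the triangle. *)
Let Phi (w : R) := 2 * G (X w) - X w * Y w.

Let S_gt0 (w : R) : 0 < 1 + w `^ q.
Proof. by rewrite ltr_pwDl// powR_ge0. Qed.

Let Y_gt0 (w : R) : 0 < Y w.
Proof. by rewrite powR_gt0. Qed.

Let Y_powR (w : R) : Y w `^ q = (1 + w `^ q)^-1.
Proof.
by rewrite /Y -powRrM mulNr mulVf ?gt_eqF// powR_inv1// ltW.
Qed.

Let X_powR (w : R) : 0 <= w -> X w `^ q = 1 - Y w `^ q.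
Proof.
move=> w0; rewrite /X powRM ?(ltW (Y_gt0 w))// Y_powR.
have := S_gt0 w; move: (w `^ q) => v v0; field.
by rewrite gt_eqF.
Qed.

Let one_powR (x : R) : 1 `^ x = 1. Proof. by rewrite powR1. Qed.

Let X_ge0 (w : R) : 0 <= w -> 0 <= X w.
Proof. by move=> w0; rewrite mulr_ge0// ltW. Qed.

Let X_lt1 (w : R) : 0 <= w -> X w < 1.
Proof.
move=> w0; rewrite ltNge; apply/negP => X1.
have : 1 <= X w `^ q.
  rewrite -[leLHS](one_powR q); apply: ge0_ler_powR => //; first exact: ltW.
    by rewrite nnegrE.
  by rewrite nnegrE X_ge0.
by rewrite X_powR// lerBrDr gerDl leNgt powR_gt0.
Qed.

Let curve_X (w : R) : 0 <= w -> f (X w) = Y w.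
Proof.
move=> w0; rewrite /lq_curve X_powR// opprB addrC subrK -powRrM mulfV ?gt_eqF//.
by rewrite powRr1// ltW.
Qed.

Let Y_le1 (w : R) : 0 <= w -> Y w <= 1.
Proof.
by move=> w0; rewrite -curve_X// lq_curve_le1// ?X_ge0// ltW// X_lt1.
Qed.

(** Twice the sector area element is Y dX - X dY = Y^2 d(X / Y), and X / Y = w. *)
Let is_derive_Phi (w : R) : 0 < w -> is_derive w 1 Phi (Y w ^+ 2).
Proof.
move=> w_gt0; have w_ge0 := ltW w_gt0.
have d1 : is_derive w 1 (fun w : R => 1 + w `^ q) (0 + q * w `^ (q - 1)).
  by apply: is_deriveD; exact: is_derive1_powR.
have := @is_derive1_comp _ (fun y => y `^ (- q^-1)) (fun w => 1 + w `^ q) w _ _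
  (is_derive1_powR (- q^-1) (S_gt0 w)) d1.
set dY := (X in is_derive _ _ _ X) => YD.
have {}YD : is_derive w 1 Y dY by exact: YD.
have XD : is_derive w 1 X (w *: dY + Y w *: 1).
  by apply: is_deriveM; exact: is_derive_id.
have X_gt0 : 0 < X w by rewrite mulr_gt0.
have GD : is_derive w 1 (G \o X) (Y w * (w *: dY + Y w *: 1)).
  apply: is_derive1_comp; rewrite -(curve_X w_ge0).
  by apply: is_derive_lq_primitive => //; exact: X_lt1.
have XYD := is_deriveM XD YD.
have G2D := is_deriveZ 2 GD.
have := is_deriveB G2D XYD.
rewrite (_ : _ - _ = Y w ^+ 2); last by rewrite /GRing.scale/= /X; ring.
by [].
Qed.

(** Controls the end w -> 0 of the parametrisation; [Phi_sub_le] controls w -> oo. *)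
Let Phi_le (w : R) : 0 <= w -> `|Phi w| <= 2 * w.
Proof.
move=> w0; have Yw := Y_le1 w0; have Y0 := Y_gt0 w.
have X0 := X_ge0 w0; have X1 := ltW (X_lt1 w0).
have Xw : X w <= w by rewrite /X ler_piMr.
have G0 := lq_primitive_ge p_gt1 (lexx 0) X0 X1.
have G1 := lq_primitive_le p_gt1 (lexx 0) X0 X1.
rewrite !lq_primitive0 !subr0 in G0 G1.
have XY0 : 0 <= X w * Y w by rewrite mulr_ge0// ltW.
have XYX : X w * Y w <= X w by rewrite ler_piMr.
have f0 : 0 <= X w * f (X w) by rewrite mulr_ge0// lq_curve_ge0.
rewrite /Phi; move: G0 G1 XY0 XYX f0 Xw.
move: (X w) (X w * f (X w)) (X w * Y w) (G (X w)) => x xf xy g *.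
rewrite ler_norml; apply/andP; split; lra.
Qed.

Let Phi_sub_le (w : R) : 0 < w -> `|2 * G 1 - Phi w| <= 3 * w^-1.
Proof.
move=> w_gt0; have w0 := ltW w_gt0; have Yw := Y_le1 w0; have Y0 := Y_gt0 w.
have X0 := X_ge0 w0; have X1 := ltW (X_lt1 w0).
have G0 := lq_primitive_ge p_gt1 X0 X1 (lexx 1).
have G1 := lq_primitive_le p_gt1 X0 X1 (lexx 1).
have f0 : 0 <= (1 - X w) * f 1 by rewrite mulr_ge0 ?subr_ge0// lq_curve_ge0.
have XY0 : 0 <= X w * Y w by rewrite mulr_ge0// ltW.
have XYY : X w * Y w <= Y w by rewrite ler_piMl// ltW.
have YV : Y w <= w^-1 by rewrite -[leRHS]mul1r ler_pdivlMr// mulrC.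
have q1 : 1 <= q by rewrite ler_pdivlMr// mul1r gerBl.
(* As q >= 1 and both coordinates are at most 1, 1 = X^q + Y^q <= X + Y. The constant 3 then
   collects 2 (1 - X) <= 2 Y and X Y <= Y, with Y <= 1 / w. *)
have XY1 : 1 - X w <= Y w.
  have := X_powR w0; have X_gt0 : 0 < X w <= 1 by rewrite X1 mulr_gt0.
  have Y_gt01 : 0 < Y w <= 1 by rewrite Yw Y0.
  by have := ge1r_powR X_gt0 q1; have := ge1r_powR Y_gt01 q1; lra.
rewrite /Phi; move: f0 XY0 XYY YV XY1 X0 X1 G0 G1.
move: (X w) (Y w) (w^-1) (X w * Y w) (_ * f 1) (G 1) (G (X w)).
move=> x y v xy xf g1 g *; rewrite ler_norml; apply/andP; split; lra.
Qed.

Definition trig_integrand (t : R) : R :=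
  (sin t `^ (p - 2) * cos t `^ (p - 2)) /
  (sin t `^ p + cos t `^ p) `^ (2 * (p - 1) / p).
Local Notation g := trig_integrand.

Lemma trig_integrand_ge0 t : 0 <= g t.
Proof. by rewrite divr_ge0 ?mulr_ge0 ?powR_ge0. Qed.

Lemma measurable_trig_integrand : measurable_fun [set: R] g.
Proof.
have mpow (h : R -> R) e : continuous h -> measurable_fun [set: R] (fun t => h t `^ e).
  move=> ch; apply: (@measurableT_comp _ _ _ _ _ _ (fun x : R => x `^ e) _ h).
    exact: measurable_powR.
  exact: continuous_measurable_fun.
have ms e := mpow _ e (@continuous_sin R).
have mc e := mpow _ e (@continuous_cos R).
apply: measurable_funM; first exact: measurable_funM.
rewrite (_ : (fun _ => _) = (fun t => (sin t `^ p + cos t `^ p) `^ (- (2 * (p - 1) / p)))).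
  apply: (@measurableT_comp _ _ _ _ _ _ (fun x : R => x `^ _) _
    (fun t => sin t `^ p + cos t `^ p)); first exact: measurable_powR.
  exact: measurable_funD.
by apply/funext => t; rewrite powRN.
Qed.

Let sincos_gt0 (t : R) : 0 < t -> t < pi / 2 -> 0 < sin t /\ 0 < cos t.
Proof.
move=> t0 t2; have pi0 := pi_gt0 R; split.
  by apply: sin_gt0_pi; apply/andP; split => //; lra.
by apply: cos_gt0_pihalf; apply/andP; split => //; lra.
Qed.

Let continuous_powR_at (h : R -> R) e (t : R) : {for t, continuous h} -> 0 < h t ->
  {for t, continuous (fun x => h x `^ e)}.
Proof.
move=> ch ht; apply: (@continuous_comp _ _ _ h (fun x : R => x `^ e)) => //.
apply/differentiable_continuous/derivable1_diffP.
exact: (@ex_derive _ _ _ _ _ _ _ (is_derive1_powR e ht)).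
Qed.

Lemma continuous_trig_integrand (t : R) : 0 < t -> t < pi / 2 ->
  {for t, continuous g}.
Proof.
move=> t0 t2; have [s0 c0] := sincos_gt0 t0 t2.
have cs e := @continuous_powR_at sin e t (@continuous_sin R t) s0.
have cc e := @continuous_powR_at cos e t (@continuous_cos R t) c0.
have D0 : 0 < sin t `^ p + cos t `^ p by rewrite addr_gt0// powR_gt0.
apply: continuousM; first by apply: continuousM; [exact: cs|exact: cc].
rewrite (_ : (fun _ => _) = (fun t => (sin t `^ p + cos t `^ p) `^ (- (2 * (p - 1) / p)))).
  apply: (@continuous_powR_at (fun t => sin t `^ p + cos t `^ p)) => //.
  by apply: continuousD; [exact: cs|exact: cc].
by apply/funext => x; rewrite powRN.
Qed.

Let slope (t : R) := tan t `^ (p - 1).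

(** The pullback of Y^2 dw under w = tan^(p-1). Since (p - 1) q = p, the factor 1 + w^q becomes
    (sin^p + cos^p) / cos^p. *)
Let Y2_slope (t : R) : 0 < t -> t < pi / 2 ->
  Y (slope t) ^+ 2 * ((p - 1) * tan t `^ (p - 2) * cos t ^- 2) = (p - 1) * g t.
Proof.
move=> t0 t2; have [s0 c0] := sincos_gt0 t0 t2.
have s_ge0 := ltW s0; have c_ge0 := ltW c0.
have cV_ge0 : 0 <= (cos t)^-1 by rewrite invr_ge0.
have tanE e : tan t `^ e = sin t `^ e / cos t `^ e.
  by rewrite /tan powRM// -(powR_inv1 c_ge0) -powRrM mulN1r powRN.
set D := sin t `^ p + cos t `^ p.
have D_gt0 : 0 < D by rewrite addr_gt0// powR_gt0.
have cp0 : cos t `^ p != 0 by rewrite gt_eqF// powR_gt0.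
have YE : Y (slope t) = D `^ (- q^-1) * cos t `^ (p - 1).
  rewrite /Y /slope -powRrM mulr_subr1_conjugate// tanE.
  rewrite (_ : 1 + _ = D * cos t `^ (- p)); last by rewrite powRN /D; field.
  rewrite powRM ?powR_ge0 ?(ltW D_gt0)// -powRrM mulrNN; congr (_ * _ `^ _).
  by rewrite /conjugate invf_div mulrCA divff ?mulr1// gt_eqF// (lt_trans ltr01).
have c1E : cos t `^ (p - 1) = cos t `^ (p - 2) * cos t.
  have -> : p - 1 = (p - 2) + 1 by ring.
  by rewrite powRD ?powRr1// (gt_eqF c0) implybT.
have DE : D `^ (- q^-1) ^+ 2 = (D `^ (2 * (p - 1) / p))^-1.
  rewrite expr2 -powRD ?(gt_eqF D_gt0) ?implybT// -powRN; congr (_ `^ _).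
  by rewrite /conjugate invf_div; ring.
rewrite YE exprMn DE c1E tanE /g -/D.
have := powR_gt0 (p - 2) c0; have := powR_gt0 (2 * (p - 1) / p) D_gt0.
move: (D `^ (2 * (p - 1) / p)) (cos t `^ (p - 2)) (sin t `^ (p - 2)).
move=> d c' s' d0 c'0; field.
by rewrite !gt_eqF.
Qed.

Let is_derive_slope (t : R) : 0 < t -> t < pi / 2 ->
  is_derive t 1 (Phi \o slope) ((p - 1) * g t).
Proof.
move=> t0 t2; have [s0 c0] := sincos_gt0 t0 t2.
have tan0 : 0 < tan t by rewrite divr_gt0.
rewrite -Y2_slope//; apply: is_derive1_comp.
  by apply: is_derive_Phi; rewrite powR_gt0.
apply: (@is_derive1_comp _ (fun x => x `^ (p - 1)) tan); last first.
  by apply: is_derive_tan; rewrite gt_eqF.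
have := is_derive1_powR (p - 1) tan0.
by rewrite (_ : p - 1 - 1 = p - 2)//; ring.
Qed.

(** The segment avoids 0 and pi / 2, near which the integrand is unbounded when p < 2. *)
Let integral_segment (a b : R) : 0 < a -> a < b -> b < pi / 2 ->
  (\int[leb]_(t in `[a, b]) (g t)%:E =
   ((p - 1)^-1 * (Phi (slope b) - Phi (slope a)))%:E)%E.
Proof.
move=> a0 ab b2.
pose F t := (p - 1)^-1 * Phi (slope t).
have FD t : 0 < t -> t < pi / 2 -> is_derive t 1 F (g t).
  move=> t0 t2; have := is_deriveZ (p - 1)^-1 (is_derive_slope t0 t2).
  by rewrite scalerA mulVf ?gt_eqF// scale1r.
have cF t : 0 < t -> t < pi / 2 -> {for t, continuous F}.
  move=> t0 t2; apply/differentiable_continuous/derivable1_diffP.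
  exact: (@ex_derive _ _ _ _ _ _ _ (FD t t0 t2)).
have b0 := lt_trans a0 ab; have a2 := lt_trans ab b2.
rewrite (@continuous_FTC2 _ g F a b ab).
- by rewrite -EFinB -mulrBr.
- apply: continuous_in_subspaceT => t /set_mem /=; rewrite in_itv/= => /andP[at_ tb].
  by apply: continuous_trig_integrand; [exact: lt_le_trans at_|exact: le_lt_trans b2].
- split.
  + move=> t; rewrite in_itv/= => /andP[at_ tb].
    apply: (@ex_derive _ _ _ _ _ _ _ (FD t _ _)).
      exact: lt_trans at_.
    exact: lt_trans b2.
  + by apply: cvg_at_right_filter; exact: cF.
  + by apply: cvg_at_left_filter; exact: cF.
- move=> t; rewrite in_itv/= => /andP[at_ tb]; rewrite derive1E.
  by have [_ ->] := FD t (lt_trans a0 at_) (lt_trans tb b2).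
Qed.

(** Segments exhausting the open interval are integrated explicitly. Their integrals converge to the
    full one by monotone convergence, and to the sector area by the two end estimates on [Phi]. *)
Lemma integral_trig_integrand :
  (p - 1) * \int[leb]_(t in `[0, pi / 2]) g t = 2 * G 1.
Proof.
have pi20 : 0 < pi / 2 :> R by rewrite divr_gt0// pi_gt0.
(* Chosen so that [slope] takes the values 1 / (n + 2) and n + 2 at the ends of the segment;
   starting at 2 makes [u n] exceed 1. *)
pose u n : R := n.+2%:R `^ (p - 1)^-1.
have u_gt1 n : 1 < u n.
  rewrite -[ltLHS](one_powR (p - 1)^-1); apply: gt0_ltr_powR; rewrite ?invr_gt0 ?nnegrE//.
  by rewrite ltr1n.
have u_gt0 n : 0 < u n by exact: lt_trans (u_gt1 n).
have uV_lt n : (u n)^-1 < u n by rewrite (lt_trans _ (u_gt1 n))// invf_lt1.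
have u_pow n : u n `^ (p - 1) = n.+2%:R by rewrite -powRrM mulVf ?gt_eqF// powRr1.
have uV_pow n : (u n)^-1 `^ (p - 1) = n.+2%:R^-1.
  by rewrite -(powR_inv1 (ltW (u_gt0 n))) -powRrM mulN1r powRN u_pow.
pose a n := atan (u n)^-1; pose b n := atan (u n).
have atan_gt0 (x : R) : 0 < x -> 0 < atan x by move=> x0; rewrite -atan0 lt_atan.
have slope_b n : slope (b n) = n.+2%:R by rewrite /slope atanK.
have slope_a n : slope (a n) = n.+2%:R^-1 by rewrite /slope atanK.
have segE n : (\int[leb]_(t in `[a n, b n]) (g t)%:E =
    ((p - 1)^-1 * (Phi n.+2%:R - Phi n.+2%:R^-1))%:E)%E.
  rewrite integral_segment ?slope_a ?slope_b//.
  - by rewrite atan_gt0// invr_gt0.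
  - by rewrite lt_atan.
  - exact: atan_ltpi2.
have mg : measurable_fun [set: R] (EFin \o g).
  by apply/measurable_EFinP; exact: measurable_trig_integrand.
have segs : \bigcup_n `[a n, b n]%classic = `]0, pi / 2[%classic.
  apply/seteqP; split => [t [n _]|t] /=; rewrite !in_itv/= => /andP[h1 h2].
    rewrite (lt_le_trans _ h1) ?atan_gt0 ?invr_gt0//.
    by rewrite (le_lt_trans h2)// atan_ltpi2.
  have [s0 c0] := sincos_gt0 h1 h2.
  have tan0 : 0 < tan t by rewrite divr_gt0.
  have tK : atan (tan t) = t by rewrite tanK// in_itv/= h2 andbT; lra.
  pose w := slope t; have w_gt0 : 0 < w by rewrite powR_gt0.
  (* This index dominates both [w] and its inverse, which places [t] in the n-th segment. *)
  pose n := (Num.truncn w + Num.truncn w^-1)%N.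
  have wn : w <= n.+2%:R.
    have /andP[_ /ltW h] := truncn_itv (ltW w_gt0); apply: (le_trans h).
    by rewrite ler_nat ltnS leqW// /n leq_addr.
  have wVn : w^-1 <= n.+2%:R.
    have wV0 : 0 <= w^-1 by rewrite invr_ge0 ltW.
    have /andP[_ /ltW h] := truncn_itv wV0; apply: (le_trans h).
    by rewrite ler_nat ltnS leqW// /n leq_addl.
  have wE : tan t = w `^ (p - 1)^-1.
    by rewrite -powRrM mulfV ?gt_eqF// powRr1// ltW.
  have pV0 : 0 <= (p - 1)^-1 by rewrite invr_ge0 ltW.
  have le_atan (x y : R) : x <= y -> atan x <= atan y.
    by rewrite le_eqVlt => /predU1P[->//|/lt_atan/ltW].
  exists n => //=; rewrite in_itv/= -tK; apply/andP; split; apply: le_atan.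
    rewrite invf_ple ?posrE//; apply: (@le_trans _ _ (w^-1 `^ (p - 1)^-1)).
      by rewrite wE -(powR_inv1 (ltW w_gt0)) -[in leRHS]powRrM mulN1r powRN.
    by apply: ge0_ler_powR => //; rewrite nnegrE ?invr_ge0 ltW.
  by rewrite wE; apply: ge0_ler_powR => //; rewrite nnegrE ltW.
have cvg1 : (\int[leb]_(t in `[a n, b n]) (g t)%:E)%E @[n --> \oo] -->
    (\int[leb]_(t in `[0%R, (pi / 2)%R]) (g t)%:E)%E.
  rewrite -integral_itv_bndo_bndc; last exact: measurable_funTS.
  rewrite -integral_itv_obnd_cbnd; last exact: measurable_funTS.
  rewrite -segs; apply: ge0_nondecreasing_set_cvg_integral.
  - move=> m n mn; apply/subsetPset => t /=; rewrite !in_itv/= => /andP[h1 h2].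
    have um : u m <= u n.
      apply: ge0_ler_powR; rewrite ?nnegrE// ?invr_ge0; first exact: ltW.
      by rewrite ler_nat.
    have le_atan (x y : R) : x <= y -> atan x <= atan y.
      by rewrite le_eqVlt => /predU1P[->//|/lt_atan/ltW].
    rewrite (le_trans _ h1) ?(le_trans h2)// le_atan//.
    by rewrite lef_pV2 ?posrE.
  - by move=> n; exact: measurable_itv.
  - by move=> n; exact: measurable_funTS.
  - by move=> n t _; rewrite lee_fin trig_integrand_ge0.
have cvg2 : (\int[leb]_(t in `[a n, b n]) (g t)%:E)%E @[n --> \oo] -->
    ((p - 1)^-1 * (2 * G 1))%:E.
  rewrite (eq_cvg _ _ segE); apply: cvg_EFin; first by near=> n.
  apply: cvgMr.
  apply/cvgrPdist_le => /= e e0; near=> n.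
  have n2 : (0 : R) < n.+2%:R by [].
  have h1 := Phi_sub_le n2.
  have h2 : `|Phi n.+2%:R^-1| <= 2 * n.+2%:R^-1 by apply: Phi_le; rewrite invr_ge0.
  (* The constant 5 is 3 from [Phi_sub_le] plus 2 from [Phi_le]. *)
  have h3 : 5 * n.+2%:R^-1 <= e.
    rewrite ler_pdivrMr// -ler_pdivrMl//.
    apply: (@le_trans _ _ n%:R); last by rewrite ler_nat leqW.
    by near: n; exact: nbhs_infty_ger.
  rewrite opprB addrCA addrC; apply: (le_trans (ler_normD _ _)).
  by move: h1 h2 h3; move: (n.+2%:R^-1) (`|_ - _|) (`|_|) => *; lra.
rewrite /Rintegral (cvg_unique _ cvg1 cvg2)//=.
by rewrite mulrA mulfV ?gt_eqF// mul1r.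
Unshelve. all: by end_near. Qed.

End TrigonometricIntegral.

(** * The lower bound, from a triangle with a vertex at the origin *)

Section StandardTriangle.
Context {R : realType}.
Variable p : R.
Hypothesis p_gt1 : 1 < p.

Local Notation plane := (measurableTypeR R * measurableTypeR R)%type.
Local Notation leb := (@lebesgue_measure R).
Local Notation f := (lq_curve p).
Local Notation G := (lq_primitive p).

Definition triangle : set (R * R) :=
  [set z | [/\ 0 <= z.1, 0 <= z.2 & z.1 + z.2 <= 1]].

Lemma convex_body_triangle : convex_body triangle.
Proof.
split; first by exists (0, 0); split => //=; rewrite addr0.
- rewrite (_ : triangle = (`[0, 1] `*` `[0, 1]) `&` [set z | dot z (1, 1) <= 1]).
    apply: compact_closedI; last exact: closed_halfplane.
    by apply: compact_setX; exact: segment_compact.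
  apply/seteqP; split => [z [z1 z2 z12]|z [[]]].
    split; last by rewrite /= /dot/= !mulr1.
    by split; rewrite /= in_itv/= ?z1 ?z2 (le_trans _ z12)// ?lerDl ?lerDr.
  rewrite /= /dot/= !in_itv/= !mulr1 => /andP[z1 _] /andP[z2 _] z12.
  by split.
apply: convex_setI01 => x y t [x1 x2 x12] [y1 y2 y12] t0 t1.
have t'0 : 0 <= 1 - t by rewrite subr_ge0.
split; rewrite /= ?addr_ge0 ?mulr_ge0//.
have := lerD (ler_wpM2l t0 x12) (ler_wpM2l t'0 y12).
rewrite !mulr1 addrCA subrr addr0; apply: le_trans.
by rewrite le_eqVlt /GRing.scale/=; apply/orP; left; apply/eqP; ring.
Qed.

Let cT : compact triangle. Proof. by case: convex_body_triangle. Qed.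

Let T0 : triangle (0, 0). Proof. by split => //=; rewrite addr0. Qed.

Lemma area_sections (A : set (R * R)) :
  area A = (\int[leb]_x leb (xsection A x))%E.
Proof. by []. Qed.

Let m1B : measurable_fun [set: R] (fun x : R => 1 - x).
Proof. exact: measurable_funB. Qed.

(** The integral form is reused for the part of the p-sum above the horizontal axis. *)
Lemma area_triangle_integral :
  area triangle = (\int[leb]_(x in `[0%R, 1%R]) (1 - x)%:E)%E.
Proof.
rewrite area_sections [RHS]integral_mkcond; apply: eq_integral => x _.
rewrite patchE; case: ifPn => [|]; rewrite ?notin_setE ?inE/= in_itv/=.
  move=> /andP[x0 x1]; rewrite (_ : xsection _ _ = `[0, 1 - x]%classic).
    rewrite lebesgue_measure_itv/= lte_fin oppr0 adde0; case: ltgtP => //= h.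
    - by move: h; rewrite ltNge subr_ge0 x1.
    - by rewrite -h.
  apply/seteqP; split => y; rewrite /xsection/= inE in_itv/=.
    by move=> [/= _ y0 xy]; rewrite y0 lerBrDl.
  by move=> /andP[y0]; rewrite lerBrDl.
move=> nx; rewrite (_ : xsection _ _ = set0) ?measure0//.
apply/seteqP; split => // y; rewrite /xsection/= inE => -[/= x0 y0 xy].
by move: nx; rewrite x0 (le_trans _ xy)// lerDl.
Qed.

Lemma area_triangle : area triangle = (2^-1)%:E.
Proof.
rewrite area_triangle_integral.
pose F (x : R) := x - 2^-1 * x ^+ 2.
have FD (x : R) : is_derive x 1 F (1 - x).
  have := is_deriveB (is_derive_id x (1 : R)) 
    (is_deriveZ 2^-1 (is_deriveX 2 (is_derive_id x (1 : R)))).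
  by rewrite (_ : 1 - _ = 1 - x)// /GRing.scale/= expr1; field.
have cF : continuous F.
  move=> x; apply/differentiable_continuous/derivable1_diffP.
  exact: (@ex_derive _ _ _ _ _ _ _ (FD x)).
rewrite (@continuous_FTC2 _ (fun x => 1 - x) F 0 1 ltr01).
- by rewrite -EFinB /F; congr (_%:E); field.
- apply: continuous_subspaceT => x.
  by apply: cvgB; [exact: cvg_cst|exact: cvg_id].
- split.
  + by move=> x _; exact: (@ex_derive _ _ _ _ _ _ _ (FD x)).
  + by apply: cvg_at_right_filter; exact: cF.
  + by apply: cvg_at_left_filter; exact: cF.
- by move=> x _; rewrite derive1E; have [_ ->] := FD x.
Qed.

Local Notation N := (psum_set p triangle (reflect_body triangle)).

Let is_psum_N : is_psum p triangle (reflect_body triangle) N.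
Proof.
have bT := convex_body_triangle; apply: psum_set_is_psum => //.
  exact: convex_body_reflect.
by exists (0, 0) => //; exact: oppr0.
Qed.

Let cN : compact N. Proof. by case: is_psum_N => -[]. Qed.

(** For y >= 0 the point is in the triangle itself, with coefficients (1, 0). For y < 0 it is x (1,
    0) + (-y) (-(0, 1)), and (x, -y) lies under the curve. *)
Let N_section (x y : R) : 0 <= x -> x <= 1 -> - f x <= y -> y <= 1 - x -> N (x, y).
Proof.
move=> x0 x1 fy yx; have [y0|y_lt0] := leP 0 y.
  exists (1, 0).
    split => //= s t s0 t0.
    have [_ _ /(_ s t s0 t0)] := lq_ball_curve p_gt1 ler01 (lexx 1).
    by apply: le_trans; rewrite lerD2l mul0r mulr_ge0// lq_curve_ge0.
  exists (x, y); first by split => //=; rewrite addrC -lerBrDr.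
  exists (- (0, 0)); first by exists (0, 0).
  by apply: plane_eq; rewrite /= /GRing.scale/=; ring.
exists (x, - y).
  have [_ _ h] := lq_ball_curve p_gt1 x0 x1.
  split => //= [|s t s0 t0]; first by rewrite oppr_ge0 ltW.
  by apply: le_trans (h s t s0 t0); rewrite lerD2l ler_wpM2r//= lerNl.
exists (1, 0); first by split => //=; rewrite addr0.
exists (- (0, 1)); first by exists (0, 1) => //; split => //=; rewrite add0r.
by apply: plane_eq; rewrite /= /GRing.scale/=; ring.
Qed.

Let lq_ballC (c : R * R) : lq_ball p c -> lq_ball p (c.2, c.1).
Proof.
by move=> [c1 c2 h]; split => //= s t s0 t0; rewrite addrC [_ `^ _ + _]addrC h.
Qed.

Let N_opp z : N z -> N (- z).
Proof.
move=> [c /lq_ballC Bc [x Tx [_ [y Ty <-] <-]]]; exists (c.2, c.1) => //.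
exists y => //; exists (- x); first by exists x.
by apply: plane_eq; rewrite /= /GRing.scale/=; ring.
Qed.

(** Leaving out the vertical axis makes this strip disjoint from its reflection. *)
Let right : set plane := `]0, 1]%classic `*` [set: R].

Let mright : measurable right.
Proof. by apply: measurableX => //; exact: measurable_itv. Qed.

Let mN : measurable (N : set plane).
Proof. exact: compact_measurable_plane. Qed.

(** By [N_section] the vertical section at x contains an interval of length 1 - x + f x; integrate
    over x. *)
Lemma area_psum_triangle_right :
  ((2^-1 + G 1)%:E <= area (N `&` right))%E.
Proof.
have mNr : measurable (N `&` right : set plane) by exact: measurableI.
have if_ : leb.-integrable `[0, 1] (EFin \o f) by exact: integrable_lq_curve.
have -> : (2^-1 + G 1)%:E = (\int[leb]_(x in `]0%R, 1%R]) (1 - x + f x)%:E)%E.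
  rewrite integral_itv_obnd_cbnd; last first.
    apply/measurable_EFinP/measurable_funTS; apply: measurable_funD => //.
    exact: measurable_lq_curve.
  under eq_integral do rewrite EFinD.
  rewrite ge0_integralD//=; last 4 first.
  - by move=> x; rewrite in_itv/= => /andP[_ x1]; rewrite lee_fin subr_ge0.
  - by apply/measurable_EFinP/measurable_funTS.
  - by move=> x _; rewrite lee_fin lq_curve_ge0.
  - by apply/measurable_EFinP/measurable_funTS; exact: measurable_lq_curve.
  rewrite -area_triangle_integral area_triangle EFinD; congr (_ + _)%E.
  by rewrite /lq_primitive /Rintegral fineK//; exact: integrable_fin_num.
rewrite area_sections integral_mkcond; apply: ge0_le_integral => //.
- move=> x _; rewrite patchE; case: ifPn => //; rewrite inE/= in_itv/= => /andP[_ x1].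
  by rewrite lee_fin addr_ge0 ?subr_ge0// lq_curve_ge0.
- apply/(measurable_restrict _ _ _) => //; rewrite setTI.
  apply/measurable_EFinP/measurable_funTS; apply: measurable_funD => //.
  exact: measurable_lq_curve.
- exact: measurable_fun_xsection.
move=> x _; rewrite patchE; case: ifPn => [|_]; last exact: measure_ge0.
rewrite inE/= in_itv/= => /andP[x0 x1].
have fx0 := lq_curve_ge0 p x.
apply: (@le_trans _ _ (leb `[- f x, 1 - x])).
  rewrite lebesgue_measure_itv/= lte_fin; case: ltgtP => //= h.
  - by rewrite -EFinB opprK.
  - by move: h; rewrite ltNge (le_trans _ (_ : 0 <= 1 - x))// ?oppr_le0// subr_ge0.
  - by rewrite lee_fin -h addNr.
apply: le_measure; rewrite ?inE//; first exact: measurable_xsection.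
move=> y; rewrite /= in_itv/= /xsection/= inE => /andP[h1 h2]; split.
  by apply: N_section => //; exact: ltW.
by split => //; rewrite /= in_itv/= x0.
Qed.

(** By the central symmetry of the p-sum, the left half has the same area as the right one. *)
Lemma vol_psum_triangle : 1 + 2 * G 1 <= vol N.
Proof.
rewrite -lee_fin -areaE//.
have mNr : measurable (N `&` right : set plane) by exact: measurableI.
pose left := (fun z : R * R => -1 *: z + 0) @^-1` (N `&` right).
have leftE : left = N `&` (`[-1, 0[%classic `*` [set: R]).
  apply/seteqP; split=> z; rewrite /left/= scaleN1r addr0.
    move=> [/N_opp]; rewrite opprK => Nz [/=]; rewrite !in_itv/= => /andP[h1 h2] _.
    by split => //; split => //; rewrite lerNl h2 -oppr_gt0.
  move=> [Nz [/=]]; rewrite !in_itv/= => /andP[h1 h2] _.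
  by split; [exact: N_opp|split => //=; rewrite in_itv/= oppr_gt0 h2 lerNl].
have mleft : measurable (left : set plane).
  by rewrite leftE; apply: measurableI => //; apply: measurableX => //;
    exact: measurable_itv.
have areal : area left = area (N `&` right).
  rewrite -(@area_preimage_homothety _ (-1) 0 _ _ mNr) ?oppr_eq0 ?oner_neq0//.
  by rewrite sqrrN expr1n mul1e.
apply: (@le_trans _ _ (area ((N `&` right) `|` left))); last first.
  apply: le_measure; rewrite ?inE//; first exact: measurableU.
  by move=> z [[]//|]; rewrite leftE => -[].
rewrite [leRHS](measureU _ mNr mleft); last first.
  apply/seteqP; split => // z [[_ [/= + _]]]; rewrite leftE => + [_ [/= + _]].
  by rewrite !in_itv/= => /andP[h1 _] /andP[_ h2]; have := lt_trans h1 h2; rewrite ltxx.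
rewrite -/(area _) -[X in (_ + X)%E]/(area left) areal.
have := area_psum_triangle_right; set a := area _ => h.
apply: le_trans (leeD h h); rewrite -EFinD lee_fin; lra.
Qed.

Lemma psum_area_bound_ge (c : R) : psum_area_bound p c -> 2 + 4 * G 1 <= c.
Proof.
move=> /(_ _ _ convex_body_triangle T0 is_psum_N).
rewrite area_triangle areaE// -EFinM lee_fin => h.
have := le_trans vol_psum_triangle h; lra.
Qed.

End StandardTriangle.

Unset Implicit Arguments.

Theorem mainTheorem5 (R : realType) (p : R) (hp : 1 < p) :
  is_best_constant p
    (2 * (1 + (p - 1) *
      \int[lebesgue_measure]_(t in `[0, pi / 2])
        ((sin t `^ (p - 2) * cos t `^ (p - 2)) /
         (sin t `^ p + cos t `^ p) `^ (2 * (p - 1) / p)))).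
Proof.
(* The constant becomes 2 + 4 G(1), where G(1) is the area under the l_q curve. *)
rewrite (integral_trig_integrand hp).
rewrite (_ : 2 * (1 + _) = 2 + 4 * lq_primitive p 1); last by ring.
split=> [K M bK K0 MK|c]; last exact: psum_area_bound_ge.
have [_ cK _] := bK; have [[_ cM _] _] := MK.
rewrite (areaE cM) (areaE cK) -EFinM lee_fin.
by apply: vol_psum_le MK _ => //; exact: lq_riemann_sum.
Qed.
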